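(* Let $K=\mathbb{Q}(t)$. For integers $d\geq 1$ and $B\geq 0$, let $\mathcal{P}_d(B)$ be the set of polynomials $f\in\mathbb{Z}[t]$ of degree at most $d$ all of whose coefficients have absolute value at most $B$. For $\gamma,c\in\mathbb{Z}[t]$ let $\phi_{(\gamma,c)}(x):=(x-\gamma)^2+c\in K[x]$, and let $$\mathrm{Sur}_d(B):=\{(\gamma,c)\in\mathcal{P}_d(B)\times\mathcal{P}_d(B) : G_K(\phi_{(\gamma,c)})=\mathrm{Aut}(T_2)\}.$$ Then for every $d\geq 1$, $$\#\mathrm{Sur}_d(B)=(2B+1)^{2d+2}+O\big(B^{2d+2-1/2}\log B\big),$$ where the $O$-estimate is as $B\to\infty$ with $d$ fixed (the implied constant may depend on $d$). In particular, $$\lim_{B\to\infty}\frac{\#\mathrm{Sur}_d(B)}{\#\big(\mathcal{P}_d(B)\times\mathcal{P}_d(B)\big)}=1 .$$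
   Context: For a polynomial $\phi\in K[x]$ of degree $d\geq 2$ all of whose iterates $\phi^n$ ($n\ge 1$) have non-zero discriminant, let $T_d$ be the infinite $d$-ary rooted tree whose vertices are the iterated preimages of $0$ under $\phi$ in $\overline{K}$ (level $n$ consists of the roots of $\phi^n$, with root vertex $0$ at level $0$), where a vertex $\alpha$ at level $n\ge 1$ is joined to the vertex $\phi(\alpha)$ at level $n-1$. Let $K_n(\phi)$ be the splitting field of $\phi^n$ over $K$, let $G_{K,n}(\phi)=\mathrm{Gal}(K_n(\phi)/K)$, and let $G_K(\phi)=\varprojlim G_{K,n}(\phi)$ with respect to restriction. Then $G_K(\phi)$ embeds in the group $\mathrm{Aut}(T_d)$ of rooted tree automorphisms. The condition $G_K(\phi)=\mathrm{Aut}(T_2)$ means that all iterates of $\phi$ are separable and this embedding (for $d=2$) is onto. *)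

(* Defs.v *)
From HB Require Import structures.
From mathcomp Require Import all_boot all_order all_algebra all_field.
From mathcomp Require Import finmap.
From mathcomp Require Import all_classical all_reals all_analysis.
Set Implicit Arguments.
Unset Strict Implicit.
Unset Printing Implicit Defensive.
Import Order.TTheory GRing.Theory Num.Theory.
Import numFieldNormedType.Exports.
Local Open Scope classical_set_scope.
Local Open Scope ring_scope.

Section Arboreal.
(* L plays the role of an algebraic closure of K; iota is the inclusion. *)
Variables (K L : fieldType) (iota : {rmorphism K -> L}) (phi : {poly K}).

(* phi^n (n-fold composition), with phi^0 = 'X. *)
Definition iterp (n : nat) : {poly K} := iter n (comp_poly phi) 'X.

Definition iter_root (n : nat) : pred L := root (map_poly iota (iterp n)).

(* K_n(phi): the subfield of L generated by K and the roots of phi^n. *)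
Definition splitting_subfield (n : nat) : set L :=
  smallest (fun S : set L => divring_closed [in S])
    (range iota `|` [set x | iter_root n x]).

(* Gal(K_n(phi) / K). An automorphism of K_n(phi) is represented by a function
   on L, of which only the restriction to K_n(phi) matters. *)
Definition Gal_level (n : nat) : set (L -> L) :=
  [set s : L -> L | [/\ set_bij (splitting_subfield n) (splitting_subfield n) s,
               {in splitting_subfield n &, {morph s : x y / x + y}},
               {in splitting_subfield n &, {morph s : x y / x * y}} &
               forall a, s (iota a) = iota a]].

(* G_K(phi): the inverse limit of the Gal(K_n(phi) / K) under restriction. *)
Definition Gal_lim : set (nat -> L -> L) :=
  [set g : nat -> L -> L | (forall n, Gal_level n (g n)) /\
           (forall n, {in splitting_subfield n, g n.+1 =1 g n})].

(* A vertex is recorded together with its level, so that the levels are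
   disjoint even if some element of L is a root of two different iterates. *)
Definition vertex := {v : nat * L | iter_root v.1 v.2}.

Definition level (v : vertex) : nat := (val v).1.
Definition point (v : vertex) : L := (val v).2.

Fact iter_root0 : iter_root 0 0.
Proof. by rewrite /iter_root /= map_polyX rootX. Qed.

Definition tree_root : vertex := exist _ (0%N, 0) iter_root0.

Definition parent_of (w v : vertex) : bool :=
  (level v == (level w).+1) && (point w == (map_poly iota phi).[point v]).

Definition adjacent (v w : vertex) : bool := parent_of v w || parent_of w v.

(* Automorphisms of the rooted tree: graph automorphisms fixing the root. *)
Definition tree_aut : set (vertex -> vertex) :=
  [set s : vertex -> vertex | [/\ bijective s, s tree_root = tree_root &
               forall v w, adjacent (s v) (s w) = adjacent v w]].

(* s is the image of g under the embedding of G_K(phi) in the automorphism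
   group of the tree. *)
Definition induces (g : nat -> L -> L) (s : vertex -> vertex) : Prop :=
  forall v, level (s v) = level v /\ point (s v) = g (level v) (point v).

Definition arboreal_surjective : Prop :=
  (forall n, (0 < n)%N -> separable_poly (iterp n)) /\
  (forall s, tree_aut s -> exists2 g, Gal_lim g & induces g s).

End Arboreal.

Notation Qt := {fraction {poly rat}}.

Definition Zt_to_Qt (f : {poly int}) : Qt :=
  tofrac (map_poly (intr : int -> rat) f).

Definition quad (gamma c : {poly int}) : {poly Qt} :=
  ('X - (Zt_to_Qt gamma)%:P) ^+ 2 + (Zt_to_Qt c)%:P.

Definition bounded_polys (d B : nat) : set {poly int} :=
  [set f | (size f <= d.+1)%N /\ forall i, `|f`_i| <= B%:Z].

Definition poly_pairs (d B : nat) : set ({poly int} * {poly int}) :=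
  bounded_polys d B `*` bounded_polys d B.

Definition Sur (L : fieldType) (iota : {rmorphism Qt -> L}) (d B : nat) :
    set ({poly int} * {poly int}) :=
  [set gc | poly_pairs d B gc /\ arboreal_surjective iota (quad gc.1 gc.2)].

(* The cardinality of a finite set (fset_set sends infinite sets to fset0). *)
Definition card_set (T : choiceType) (A : set T) : nat := #|` fset_set A|%fset.

(* Main.v *)
Require Import Defs.
From HB Require Import structures.
From mathcomp Require Import all_boot all_order all_algebra all_field.
From mathcomp Require Import finmap generic_quotient.
From mathcomp Require Import all_classical all_reals all_analysis.
From mathcomp Require Import ring lra zify.
Set Implicit Arguments.
Unset Strict Implicit.
Unset Printing Implicit Defensive.
Import Order.TTheory GRing.Theory Num.Theory.
Import numFieldNormedType.Exports.
Local Open Scope ring_scope.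

(** Let [phi = (x - g)^2 + c] over [K = Q(t)] and [e = c - g]. The critical
    orbit [a_n = phi^n(g)], [n >= 1], is [a_n = v_n + g], where [v_n] is the
    orbit of [0] under [y^2 + e].

    Galois theory. The representation of a quadratic polynomial is onto as
    soon as [- a_1, a_2, a_3, ...] are independent in [K^* / K^*2]
    ([arboreal_surjective_of_crit]). The field [K_(n+1)] is [K_n] with the
    square roots of all [alpha - c] adjoined, [alpha] running over the roots
    of [phi^n]; if these elements are independent modulo squares of [K_n],
    every automorphism of [K_n] extends to [K_(n+1)] with arbitrary signs on
    these roots, which is all that a tree automorphism can ask for. Conversely
    a relation between them can be pushed down the tree: multiplying it by its
    image under the automorphism that exchanges the two children of one vertex
    turns it into a relation one level lower, and finally into the statement
    that [a_(n+1)] is a square in [K_n]. The same descent, applied to an element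
    of [K], shows that the elements of [K] that become squares in [K_n] are,
    up to squares, the products of [- a_1, a_2, ..., a_n] ([indep_all]).

    Polynomials. If [g], [c] and [e] have degree exactly [d >= 1], finitely
    many conditions imply independence at all levels ([crit_independent]):
    [- a_1] is not a square, [a_2] is not a constant times a square, and
    [a_1, ..., a_12] are pairwise coprime. Indeed, if [a_n] times a product of
    earlier terms is a square, write [a_n = D y^2] with [D] squarefree. Then
    [D] divides a product of the [a_i], [i < n]; as a common divisor of [a_i]
    and [a_n] divides [phi^(n-i)(0)], the degree of [D] is at most of order
    [2^(n/2) d], while [a_n] has degree [2^(n-1) d]. For [3 <= n <= 12]
    the polynomial [D] is constant; after a rescaling of [y] it is [1], and
    [y^2 - v_(n-1)^2 = c] factors, against the degrees. For [n > 12] the equation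
    [D y^2 = v_(n-1)^2 + c], in which [v_(n-1)] is itself obtained by two
    further steps of [y^2 + e], is excluded by differentiation
    ([sqr_twist_tower_bounded]).

    Counting. All conditions hold outside [O(B^(2d+1))] pairs. The degree
    conditions concern the leading coefficients. When [g] and the
    non-constant coefficients of [c] are fixed, the remaining conditions
    exclude boundedly many constant coefficients ([exceptional_constants]).
    For coprimality: at a common zero [t] of [a_i] and [a_j], the number
    [m = e(t)] satisfies [v_i(m) = v_j(m) = - g(t)]. So [m] lies in a finite
    set that depends neither on [g] nor on [c], next [t] is one of [d] roots
    of [g + v_i(m)], and [m] and [t] determine the constant coefficient. *)

(** * Quadratic twists of iterated squares of polynomials *)

Section SizeBounds.
Variable R : nzRingType.
Implicit Types p q : {poly R}.

Lemma size_mul_le p q m n :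
  (size p <= m.+1)%N -> (size q <= n.+1)%N -> (size (p * q)%R <= (m + n).+1)%N.
Proof.
move=> hp hq; apply: leq_trans (size_polyMleq p q) _.
move: (size p) (size q) hp hq => a b; lia.
Qed.

Lemma size_sub_le p q m :
  (size p <= m)%N -> (size q <= m)%N -> (size (p - q)%R <= m)%N.
Proof.
by move=> hp hq; apply: leq_trans (size_polyD _ _) _; rewrite size_polyN geq_max hp.
Qed.

Lemma size_add_le p q m :
  (size p <= m)%N -> (size q <= m)%N -> (size (p + q)%R <= m)%N.
Proof. by move=> hp hq; apply: leq_trans (size_polyD _ _) _; rewrite geq_max hp. Qed.

Lemma size_mulrn_le p k m : (size p <= m)%N -> (size (p *+ k)%R <= m)%N.
Proof.
by move=> hp; elim: k => [|k IH]; rewrite ?mulr0n ?size_poly0 // mulrS size_add_le.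
Qed.

Lemma size_deriv_le p m : (size p <= m)%N -> (size p^`() <= m)%N.
Proof.
move=> hp; have [->|p0] := eqVneq p 0; first by rewrite deriv0 size_poly0.
exact: leq_trans (ltnW (lt_size_deriv p0)) hp.
Qed.

Lemma coef_mul_top p q m n : (size p <= m.+1)%N -> (size q <= n.+1)%N ->
  (p * q)`_(m + n) = p`_m * q`_n.
Proof.
move=> hp hq; have hm : (m < (m + n).+1)%N by lia.
rewrite coefM (bigD1 (Ordinal hm)) //= [X in _ + X]big1 ?addr0; last first.
  move=> i; rewrite -val_eqE /= => im.
  have [lt_im|le_mi] := ltnP i m.
    by rewrite [q`_ _]nth_default ?mulr0 //; apply: leq_trans hq _; lia.
  by rewrite nth_default ?mul0r //; apply: leq_trans hp _; lia.
by congr (_ * q`_ _); lia.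
Qed.

End SizeBounds.

Section TwistedSquares.
Variable F : numFieldType.
Implicit Types p q c e w x y z D : {poly F}.

Lemma size_sqr p n : size p = n.+1 -> size (p ^+ 2)%R = (2 * n).+1.
Proof.
move=> hp; have p0 : p != 0 by rewrite -size_poly_eq0 hp.
by rewrite expr2 size_mul // hp; lia.
Qed.

Lemma dvdp_size_eq0 p q : p %| q -> (size q < size p)%N -> q = 0.
Proof.
move=> pq; have [//|q0] := eqVneq q 0.
by rewrite ltnNge dvdp_leq.
Qed.

(** The two terms have top coefficients [2 n] and [m] times the product of the
    leading coefficients, so they cannot cancel in characteristic zero. *)
Lemma wronskian_neq0 p q m n : size p = m.+1 -> size q = n.+1 -> 2 * n != m ->
  p * q^`() *+ 2 - p^`() * q != 0.
Proof.
move=> hp hq mn; apply/eqP => H.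
have: ('X * (p * q^`() *+ 2 - p^`() * q))`_(m + n) = 0 by rewrite H mulr0 coef0.
have -> : 'X * (p * q^`() *+ 2 - p^`() * q) =
          (p * ('X * q^`())) *+ 2 - ('X * p^`()) * q by ring.
have coefXd (r : {poly F}) k : ('X * r^`())`_k = r`_k *+ k.
  by rewrite coefXM; case: k => [|k] //=; rewrite coef_deriv.
have sizeXd (r : {poly F}) k : (size r <= k.+1)%N -> (size ('X * r^`())%R <= k.+1)%N.
  move=> /leq_sizeP hr; apply/leq_sizeP => j /hr; rewrite coefXd => ->.
  by rewrite mul0rn.
rewrite coefB coefMn !coef_mul_top ?sizeXd ?hp ?hq // !coefXd => /eqP.
rewrite mulrnAl mulrnAr -mulrnA subr_eq0.
have nz : p`_m * q`_n != 0.
  by rewrite -[m]/(m.+1.-1) -[n]/(n.+1.-1) -hp -hq -!lead_coefE mulf_neq0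
             ?lead_coef_eq0 -?size_poly_eq0 ?hp ?hq.
rewrite -[_ *+ (n * 2)]mulr_natr -[_ *+ m]mulr_natr (inj_eq (mulfI nz)) eqr_nat.
by rewrite mulnC (negPf mn).
Qed.

(** A twist of small degree of a three-step iterate is never a square. Without
    the inner squarings this is a Pell equation, which may have solutions of
    large degree; the argument uses that [x] and [z] are themselves of the form
    square plus [e]. Differentiating [x^2 + c = D y^2] gives a polynomial
    relation between [x], [z] and [w] whose cofactor [u] has small degree;
    reducing it modulo [z] twice, and then using [z = w^2 + e], leaves a
    non-zero multiple of [z] of smaller degree than [z]. *)
Lemma sqr_twist_tower_bounded (d dD n : nat) c e w D y :
    (0 < d)%N -> size c = d.+1 -> size e = d.+1 ->
    size w = n.+1 -> size D = dD.+1 -> (7 * d + dD < n)%N ->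
  ((w ^+ 2 + e) ^+ 2 + e) ^+ 2 + c <> D * y ^+ 2.
Proof.
move=> d0 sc se sw sD small.
set z := w ^+ 2 + e; set x := z ^+ 2 + e; move=> FE.
have sz : size z = (2 * n).+1.
  by rewrite size_polyDl (size_sqr sw) // se; lia.
have sx : size x = (2 * (2 * n)).+1.
  by rewrite size_polyDl (size_sqr sz) // se; lia.
have sF : size (x ^+ 2 + c)%R = (2 * (2 * (2 * n))).+1.
  by rewrite size_polyDl (size_sqr sx) // sc; lia.
have D0 : D != 0 by rewrite -size_poly_eq0 sD.
have c0 : c != 0 by rewrite -size_poly_eq0 sc.
have e0 : e != 0 by rewrite -size_poly_eq0 se.
have z0 : z != 0 by rewrite -size_poly_eq0 sz.
have y0 : y != 0.
  by apply/eqP => y0; move: sF; rewrite FE y0 expr0n mulr0 size_poly0.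
have [Y sy] : exists Y, size y = Y.+1.
  by exists (size y).-1; rewrite prednK // size_poly_gt0.
have hY : (2 * Y + dD = 8 * n)%N.
  move: sF; rewrite FE size_mul ?expf_neq0 // (size_sqr sy) sD; lia.
(* Up to a factor, [Q] is the derivative of [x^2 / c]. *)
pose Q := c * x^`() *+ 2 - c^`() * x.
have sQ : (size Q <= (d + 4 * n).+1)%N.
  apply: size_sub_le; [apply: size_mulrn_le|];
    by apply: size_mul_le; rewrite ?size_deriv_le ?sc ?sx //; lia.
(* [y] divides [x^2 + c] and its derivative, and [c * Q] is a combination of
   both. *)
have /dvdpP [u uE] : y %| c * Q.
  have yF : y %| x ^+ 2 + c by rewrite FE expr2 mulrA dvdp_mull.
  have yF' : y %| (x ^+ 2 + c)^`().
    have -> : (x ^+ 2 + c)^`() = y * (D^`() * y + D * y^`() *+ 2).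
      by rewrite FE derivM expr2 derivM; ring.
    exact: dvdp_mulr.
  have -> : c * Q = (x ^+ 2 + c) * Q - x * (c * (x ^+ 2 + c)^`() - c^`() * (x ^+ 2 + c)).
    by rewrite derivD expr2 derivM /Q; ring.
  apply: dvdp_sub; first exact: dvdp_mulr.
  by apply/dvdp_mull/dvdp_sub; apply: dvdp_mull.
have su : (2 * size u <= 4 * d + dD + 2)%N.
  have [->|u0] := eqVneq u 0; first by rewrite size_poly0; lia.
  have : (size (u * y)%R <= (d + (d + 4 * n)).+1)%N.
    by rewrite -uE; apply: size_mul_le; rewrite ?sc.
  by rewrite size_mul // sy; move: (size u) => k; lia.
have su2 : (size (u ^+ 2)%R <= (4 * d + dD).+1)%N.
  by apply: leq_trans (size_polyMleq u u) _; move: (size u) su => k; lia.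
have E1 : c ^+ 2 * D * Q ^+ 2 = u ^+ 2 * (x ^+ 2 + c).
  have -> : c ^+ 2 * D * Q ^+ 2 = D * (c * Q) ^+ 2 by ring.
  by rewrite uE FE; ring.
(* [E] is to [e] what [Q] is to [x]; hence [Q] and [E] agree modulo [z]. *)
pose E := c * e^`() *+ 2 - c^`() * e.
have Enz : E != 0 by apply: (wronskian_neq0 sc se); lia.
have sE : (size E <= (2 * d).+1)%N.
  apply: size_sub_le; [apply: size_mulrn_le|];
    by rewrite mul2n -addnn; apply: size_mul_le; rewrite ?size_deriv_le ?sc ?se.
pose T := c * z^`() *+ 4 - c^`() * z.
have QE : Q = z * T + E by rewrite /Q /x derivD [z ^+ 2]expr2 derivM /T /E; ring.
(* [S] is the quotient by [z] of the relation [E1] minus its value modulo [z],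
   up to sign. *)
pose S := u ^+ 2 * (z ^+ 3 + e * z *+ 2) - c ^+ 2 * D * (z * T ^+ 2 + T * E *+ 2).
have E2 : c ^+ 2 * D * E ^+ 2 - u ^+ 2 * (e ^+ 2 + c) = z * S.
  have : c ^+ 2 * D * Q ^+ 2 - u ^+ 2 * (x ^+ 2 + c) = 0 by rewrite E1 subrr.
  rewrite QE => E1'; rewrite -[LHS]subr0 -[X in _ - X]E1' /S /x; ring.
have S0 : S = 0.
  have : z * S = 0.
    apply: (@dvdp_size_eq0 z); first by rewrite dvdp_mulr.
    rewrite sz -E2 ltnS; apply: (@leq_trans (6 * d + dD).+1); last by lia.
    have sc2 : (size (c ^+ 2)%R <= (2 * d).+1)%N by rewrite (size_sqr sc).
    have sE2 : (size (E ^+ 2)%R <= (2 * (2 * d)).+1)%N.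
      by apply: leq_trans (size_polyMleq E E) _; move: (size E) sE => k; lia.
    apply: size_sub_le.
      have -> : (6 * d + dD = (2 * d + dD) + 2 * (2 * d))%N by lia.
      by apply: size_mul_le => //; apply: size_mul_le; rewrite ?sD.
    have -> : (6 * d + dD = (4 * d + dD) + 2 * d)%N by lia.
    apply: size_mul_le => //; apply: size_add_le; first by rewrite (size_sqr se).
    by rewrite sc; lia.
  by move/eqP; rewrite mulf_eq0 (negPf z0) => /eqP.
pose M := c ^+ 3 * D * E.
have zM : z %| M * z^`().
  have : z %| (M * z^`()) *+ 8.
    have -> : (M * z^`()) *+ 8 = z * (u ^+ 2 * (z ^+ 2 + e *+ 2)
        - c ^+ 2 * D * (T ^+ 2 - c^`() * E *+ 2)) - S.
      by rewrite /S /M /T; ring.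
    by rewrite S0 subr0 dvdp_mulr.
  by rewrite -scaler_nat dvdpZr // pnatr_eq0.
(* As [z = w^2 + e], the combination [e z' - e' z] equals [w R]; this trades
   [z'] for [R], which has about half the degree of [z]. *)
pose R := e * w^`() *+ 2 - e^`() * w.
have R0 : R != 0 by apply: (wronskian_neq0 se sw); lia.
have zR : z %| M * e * R.
  have -> : M * e * R = z * (M * R) - w * (e * (M * z^`()) - M * e^`() * z).
    by rewrite /R /z derivD [w ^+ 2]expr2 derivM; ring.
  apply: dvdp_sub; first exact: dvdp_mulIl.
  by apply/dvdp_mull/dvdp_sub; apply: dvdp_mull.
have /eqP : M * e * R = 0.
  apply: dvdp_size_eq0 zR _; rewrite sz ltnS.
  apply: (@leq_trans (7 * d + dD + n).+1); last by lia.
  have -> : (7 * d + dD + n = 3 * d + dD + 2 * d + d + (d + n))%N by lia.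
  apply: size_mul_le; last first.
    apply: size_sub_le; [apply: size_mulrn_le|];
    by apply: size_mul_le; rewrite ?size_deriv_le ?se ?sw.
  apply: size_mul_le; last by rewrite se.
  apply: size_mul_le => //; apply: size_mul_le; last by rewrite sD.
  rewrite exprS (_ : 3 * d = d + 2 * d)%N; last by lia.
  by apply: size_mul_le; rewrite ?sc ?(size_sqr sc).
by rewrite !mulf_eq0 (negPf e0) (negPf R0) (negPf Enz) (negPf D0) (negPf c0).
Qed.
End TwistedSquares.

(** * Squarefree parts *)

Definition sqfree_poly (F : fieldType) (D : {poly F}) :=
  forall q, q ^+ 2 %| D -> size q = 1%N.

Lemma sqfree_part (F : fieldType) (f : {poly F}) : f != 0 ->
  exists D y, f = D * y ^+ 2 /\ sqfree_poly D.
Proof.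
have [n] := ubnP (size f); elim: n f => // n IH f le_f f0.
have [[q q2f sq]|sqf] := pselect (exists2 q, q ^+ 2 %| f & size q <> 1%N); last first.
  exists f, 1; split; first by rewrite expr1n mulr1.
  by move=> q q2; have [//|/eqP nq] := eqVneq (size q) 1%N; case: sqf; exists q.
have /dvdpP [k fE] := q2f.
have q0 : q != 0 by apply: contraNneq f0 => q0; rewrite fE q0 expr0n mulr0.
have k0 : k != 0 by apply: contraNneq f0 => k0; rewrite fE k0 mul0r.
have [|//|D [y [kE sqD]]] := IH k.
  move: le_f; rewrite fE size_mul ?expf_neq0 // expr2 size_mul //.
  have : size q != 0%N by rewrite size_poly_eq0.
  by move: (size q) (size k) sq => a b; lia.
exists D, (y * q); split; last by [].
by rewrite fE kE; ring.
Qed.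

(** Every prime factor of [D] divides [h], hence divides [D * P] twice, but
    [D] only once. *)
Lemma sqfree_dvdp_cofactor (F : fieldType) (D P h : {poly F}) :
  D != 0 -> sqfree_poly D -> D * P = h ^+ 2 -> D %| P.
Proof.
move=> D0 sqD DP.
have ckl : coprimep (D %/ gcdp D h) (h %/ gcdp D h).
  by apply: coprimep_div_gcd; rewrite D0.
have Dk : D %/ gcdp D h * gcdp D h = D by rewrite divpK ?dvdp_gcdl.
have hl : h %/ gcdp D h * gcdp D h = h by rewrite divpK ?dvdp_gcdr.
have G0 : gcdp D h != 0 by rewrite gcdp_eq0 negb_and D0.
move: (gcdp D h) (D %/ gcdp D h) (h %/ gcdp D h) ckl Dk hl G0 => G k l ckl Dk hl G0.
have k0 : k != 0 by apply: contraNneq D0 => k0; rewrite -Dk k0 mul0r.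
have kG : k %| G.
  have : k * G %| (l ^+ 2 * G) * G.
    have -> : (l ^+ 2 * G) * G = h ^+ 2 by rewrite -hl; ring.
    by rewrite Dk -DP dvdp_mulr.
  by rewrite dvdp_mul2r // Gauss_dvdpr // coprimep_expr.
have /dvdpP [m hm] : D %| h.
  have /sqD/eqP : k ^+ 2 %| D by rewrite -Dk expr2 dvdp_mul2l.
  rewrite size_poly_eq1 => k1; rewrite -Dk -hl dvdp_mul2r //.
  by rewrite (eqp_dvdl _ k1) dvd1p.
have -> : P = m ^+ 2 * D by apply: (mulfI D0); rewrite DP hm; ring.
exact: dvdp_mull.
Qed.

(** * Independence of the critical orbit modulo squares *)

(** Conjugating [(x - g)^2 + e + g] by the translation by [g] gives [y^2 + e];
    so [orb e 0 n + g] is the [n]-th point of the critical orbit, and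
    [orb e (- g) n + g] is the [n]-th iterate of [0]. *)
Definition orb (R : nzRingType) (e y : R) (n : nat) : R :=
  iter n (fun u => u ^+ 2 + e) y.

(** Splits the sum at [h], which will be [n / 2], and sums two geometric series. *)
Lemma sum_min_pow2 h n : (h <= n)%N ->
  (\sum_(i < n) minn (2 ^ i) (2 ^ (n - i)) <= 2 ^ h + 2 ^ (n - h).+1)%N.
Proof.
move=> hn; rewrite -(big_mkord xpredT (fun i => minn (2 ^ i) (2 ^ (n - i)))).
rewrite (big_cat_nat (leq0n h) hn) /= leq_add //.
  apply: (@leq_trans (\sum_(0 <= i < h) 2 ^ i)).
    by apply: leq_sum => i _; rewrite geq_minl.
  elim: h {hn} => [|h IH]; first by rewrite big_geq.
  by rewrite big_nat_recr //= expnS mul2n -addnn leq_add2r.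
apply: (@leq_trans (\sum_(h <= i < n) 2 ^ (n - i))).
  by apply: leq_sum => i _; rewrite geq_minr.
have [k ->] : exists k, n = (h + k)%N by exists (n - h)%N; lia.
rewrite addKn; elim: k h {hn} => [|k IH] h; first by rewrite addn0 big_geq.
rewrite big_ltn; last by lia.
rewrite -addSnnS addSn -addnS addKn [X in (_ <= X)%N]expnS mul2n -addnn leq_add2l.
by rewrite addnS -addSn; apply: IH.
Qed.

Section Orbits.
Variables (F : numFieldType) (e : {poly F}) (d : nat).
Hypotheses (d_gt0 : (0 < d)%N) (size_e : size e = d.+1).

Let v := orb e 0.

Lemma orbS (y : {poly F}) n : orb e y n.+1 = orb e y n ^+ 2 + e.
Proof. by []. Qed.

Lemma orb_add (y : {poly F}) m n : orb e y (m + n) = orb e (orb e y m) n.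
Proof. by rewrite /orb addnC iterD. Qed.

Lemma dvdp_orb_sub (q y y' : {poly F}) n : q %| y - y' -> q %| orb e y n - orb e y' n.
Proof.
move=> qy; elim: n => [//|n IH]; rewrite !orbS.
have -> : orb e y n ^+ 2 + e - (orb e y' n ^+ 2 + e) =
  (orb e y n - orb e y' n) * (orb e y n + orb e y' n) by ring.
exact: dvdp_mulr.
Qed.

Lemma size_orb (y : {poly F}) n : size y = d.+1 -> size (orb e y n)%R = (2 ^ n * d).+1.
Proof.
move=> sy; elim: n => [|n IH]; first by rewrite mul1n.
have s2 := size_sqr IH; rewrite orbS size_polyDl s2 ?expnS ?mulnA // size_e.
by have := expn_gt0 2 n; move: (2 ^ n)%N => k; nia.
Qed.

Lemma v1 : v 1 = e.
Proof. by rewrite /v orbS /orb /= expr0n add0r. Qed.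

Lemma size_v n : size (v n.+1)%R = (2 ^ n * d).+1.
Proof. by rewrite /v -add1n orb_add -/v v1 size_orb. Qed.

Variable g : {poly F}.
Hypotheses (size_g : size g = d.+1) (size_eg : size (e + g)%R = d.+1).

Lemma size_orb_add (y : {poly F}) n : size y = d.+1 -> size (orb e y n.+1 + g)%R = (2 ^ n.+1 * d).+1.
Proof.
move=> sy; rewrite size_polyDl size_orb // size_g expnS.
by have := expn_gt0 2 n; move: (2 ^ n)%N => k; nia.
Qed.

Lemma size_crit n : size (v n.+1 + g)%R = (2 ^ n * d).+1.
Proof.
case: n => [|n]; first by rewrite v1 mul1n.
by rewrite /v -add1n orb_add -/v v1 size_orb_add.
Qed.

(** The adjusted critical orbit, indexed from [0]: the first term carries a sign
    because the product of the [alpha - c] over the roots [alpha] of [phi^n] is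
    [phi^n(c)] for [n >= 1], but [- c] for [n = 0]. *)
Definition adj_crit n := if n is n'.+1 then v n.+1 + g else - (v 1 + g).

Lemma size_adj_crit n : size (adj_crit n)%R = (2 ^ n * d).+1.
Proof. by case: n => [|n]; rewrite /adj_crit ?size_polyN size_crit. Qed.

Lemma adj_crit_neq0 n : adj_crit n != 0.
Proof. by rewrite -size_poly_eq0 size_adj_crit. Qed.

Lemma dvdp_adj_crit (q : {poly F}) i : (q %| adj_crit i) = (q %| v i.+1 + g).
Proof. by case: i => [|i] //; rewrite /adj_crit dvdpNr. Qed.

(** Modulo the [i]-th critical point the [n]-th one is the [(n - i)]-th iterate
    of [0]; so the gcd divides two polynomials of known degree. *)
Lemma gcdp_crit_deg (D : {poly F}) n i : (i < n)%N -> D %| v n.+1 + g ->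
  ((size (gcdp D (adj_crit i))%R).-1 <= minn (2 ^ i) (2 ^ (n - i)) * d)%N.
Proof.
move=> lt_in Da; set G := gcdp _ _.
have Gi : G %| v i.+1 + g by rewrite -dvdp_adj_crit dvdp_gcdr.
have bound (p : {poly F}) k : p != 0 -> size p = (2 ^ k * d).+1 -> G %| p ->
    ((size G).-1 <= 2 ^ k * d)%N.
  by move=> p0 sp Gp; have := dvdp_leq p0 Gp; rewrite sp; move: (size G) (2 ^ k * d)%N => *; lia.
rewrite minnMl leq_min; apply/andP; split.
  by apply: bound (size_crit i) Gi; rewrite -size_poly_eq0 size_crit.
have Gb : G %| orb e (- g) (n - i) + g.
  have -> : orb e (- g) (n - i) + g =
     (v n.+1 + g) - (orb e (v i.+1) (n - i) - orb e (- g) (n - i)).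
    rewrite /v (_ : n.+1 = i.+1 + (n - i))%N; last by lia.
    rewrite orb_add; ring.
  apply: dvdp_sub; first exact: dvdp_trans (dvdp_gcdl _ _) Da.
  by apply: dvdp_orb_sub; rewrite opprK.
have nz : (n - i = (n - i).-1.+1)%N by lia.
by rewrite nz in Gb *; apply: bound Gb; rewrite -?size_poly_eq0 size_orb_add // size_polyN.
Qed.

(** If [D] divides [Y f], it divides [D Y] and [Y f], hence [Y gcd(D, f)]: the
    factors can be replaced one at a time. In the proof, [X] collects those set
    aside. *)
Lemma dvdp_prod_gcdp (I : Type) (r : seq I) (P : pred I) (f : I -> {poly F}) D :
  D %| \prod_(i <- r | P i) f i -> D %| \prod_(i <- r | P i) gcdp D (f i).
Proof.
move=> Df; suff gen (X : {poly F}) : D %| \prod_(i <- r | P i) f i * X ->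
    D %| \prod_(i <- r | P i) gcdp D (f i) * X.
  by rewrite -[\prod_(i <- r | P i) gcdp _ _]mulr1; apply: gen; rewrite mulr1.
elim: r {Df} X => [|i r IH] X; rewrite ?big_nil // !big_cons; case: ifP => _; last exact: IH.
move=> D1; have : D %| \prod_(j <- r | P j) gcdp D (f j) * (f i * X).
  by apply: IH; rewrite mulrA [_ * f i]mulrC.
move: (\prod_(j <- r | P j) gcdp _ _) => Y D2.
have -> : gcdp D (f i) * Y * X = (Y * X) * gcdp D (f i) by ring.
rewrite -(eqp_dvdr _ (gcdp_mul2l _ _ _)) dvdp_gcd dvdp_mull //=.
by move: D2; congr (_ %| _); ring.
Qed.

Lemma size_prod_gcdp_le D n (b : pred nat) : D %| v n.+1 + g ->
  ((size (\prod_(i < n | b i) gcdp D (adj_crit i))%R).-1 <=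
     (\sum_(i < n) minn (2 ^ i) (2 ^ (n - i))) * d)%N.
Proof.
move=> Da; rewrite big_distrl /=.
apply: (@leq_trans (\sum_(i < n | b i) minn (2 ^ i) (2 ^ (n - i)) * d)); last first.
  by rewrite [X in (_ <= X)%N](bigID (fun i : 'I_n => b i)) /= leq_addr.
elim/big_rec2: _ => [|i k p _ IH]; first by rewrite size_poly1.
have := gcdp_crit_deg (ltn_ord i) Da; have := size_polyMleq (gcdp D (adj_crit i)) p.
move: (size _) (size _) (size _) (minn _ _ * d)%N IH => *; lia.
Qed.

Hypothesis crit_coprime : forall i j, (i < j)%N -> (j < 12)%N ->
  coprimep (v i.+1 + g) (v j.+1 + g).
Hypothesis crit0_nsq : forall y, - (e + g) <> y ^+ 2.
Hypothesis crit1_nsq : forall r : F, e + g <> (r *+ 2) *: e + (r ^+ 2)%:P.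

(** If [x^2 + c] is a constant times [y^2], the constant is a square, so
    [(y - x) (y + x) = c] after rescaling [y]. The second factor has the degree
    of [x], which exceeds [d] except at the first step, where the equation
    becomes the one excluded by hypothesis. *)
Lemma crit_not_const_sqr (k : F) n y : v n.+2 + g <> k%:P * y ^+ 2.
Proof.
have -> : v n.+2 + g = v n.+1 ^+ 2 + (e + g) by rewrite /v orbS addrA.
move xE: (v n.+1) (size_v n) => x sx.
have sF : size (x ^+ 2 + (e + g)) = (2 * (2 ^ n * d)).+1.
  rewrite size_polyDl (size_sqr sx) // size_eg.
  by have := expn_gt0 2 n; move: (2 ^ n)%N => N; nia.
move=> FE.
have x0 : x != 0 by rewrite -size_poly_eq0 sx.
have k0 : k != 0.
  by apply/eqP => k0; move: sF; rewrite FE k0 mul0r size_poly0.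
have y0 : y != 0.
  by apply/eqP => y0; move: sF; rewrite FE y0 expr0n mulr0 size_poly0.
have kE : lead_coef x ^+ 2 = k * lead_coef y ^+ 2.
  have : lead_coef (x ^+ 2 + (e + g)) = lead_coef x ^+ 2.
    rewrite lead_coefDl ?lead_coef_exp // (size_sqr sx) size_eg.
    by have := expn_gt0 2 n; move: (2 ^ n)%N => N; nia.
  by rewrite FE lead_coefM lead_coefC lead_coef_exp.
pose s := lead_coef x / lead_coef y.
have ly0 : lead_coef y != 0 by rewrite lead_coef_eq0.
have s0 : s != 0 by rewrite mulf_neq0 ?invr_eq0 // lead_coef_eq0.
have ksE : k = s ^+ 2 by rewrite expr_div_n kE mulfK // expf_neq0.
have {}FE : x ^+ 2 + (e + g) = (s *: y) ^+ 2.
  by rewrite FE ksE -mul_polyC [s ^+ 2]expr2 polyCM; ring.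
have lsy : lead_coef (s *: y) = lead_coef x by rewrite lead_coefZ divfK.
have ssy : size (s *: y) = size x.
  have s1 : s *: y != 0 by rewrite scaler_eq0 negb_or s0.
  have [m sm] : exists m, size (s *: y) = m.+1.
    by exists (size (s *: y)).-1; rewrite prednK // size_poly_gt0.
  by move: sF; rewrite FE (size_sqr sm) sm sx; lia.
(* The scaling makes the leading coefficients of [t] and [x] equal, so that
   [t - x] is the small factor and [t + x] the large one. *)
set t := s *: y in FE lsy ssy; pose p := t - x.
have tE : t = p + x by rewrite subrK.
have sp : (size p < size x)%N.
  rewrite sx ltnS; apply/leq_sizeP => j; rewrite leq_eqVlt => /predU1P[<-|lt_j].
    rewrite coefB; move: lsy; rewrite !lead_coefE ssy sx /= => ->.
    by rewrite subrr.
  by rewrite coefB !nth_default ?subrr // ?ssy sx.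
have cE : e + g = p * (x *+ 2 + p).
  by apply: (addrI (x ^+ 2)); rewrite FE tE; ring.
have p0 : p != 0.
  apply/eqP => p0; move: size_eg; rewrite cE p0 mul0r size_poly0 => /eqP.
  by [].
have sq : size (x *+ 2 + p) = size x.
  by rewrite size_polyDl -scaler_nat size_scale ?pnatr_eq0.
have : size (e + g) = (size p + size x).-1.
  by rewrite cE size_mul ?sq // -size_poly_eq0 sq sx.
have sp0 : size p != 0%N by rewrite size_poly_eq0.
rewrite size_eg sx => sE.
have n0 : n = 0%N.
  case: n sE {xE sx sF} => // n; rewrite expnS => sE.
  by have := expn_gt0 2 n; move: (2 ^ n)%N (size p) sE sp0 => N P; nia.
subst n; have /size_poly1P [r r0 pE] : size p == 1%N by apply/eqP; lia.
apply: (crit1_nsq (r := r)).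
by rewrite cE pE -xE v1 -mul_polyC polyCMn expr2 polyCM; ring.
Qed.

(** The bound [12] is where [sqr_twist_tower_bounded] takes over: for [n >= 12]
    the polynomial [w = v (n - 2)], of degree [2^(n-3) d], beats [7 d] plus the
    degree of the squarefree part, which is at most [5 * 2^(n/2) d]. *)
Theorem crit_independent n (b : pred nat) h :
  adj_crit n * \prod_(i < n | b i) adj_crit i <> h ^+ 2.
Proof.
case: n => [|n]; first by rewrite big_ord0 mulr1 /adj_crit v1.
move=> hE.
have [D [y [aE sqD]]] := sqfree_part (adj_crit_neq0 n.+1).
have D0 : D != 0.
  by apply: contraNneq (adj_crit_neq0 n.+1) => D0; rewrite aE D0 mul0r.
have y0 : y != 0.
  by apply: contraNneq (adj_crit_neq0 n.+1) => y0; rewrite aE y0 expr0n mulr0.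
have Da : D %| v n.+2 + g by rewrite -(dvdp_adj_crit D n.+1) aE dvdp_mulIl.
(* [D] times the product of earlier terms is the square of [h / y]. *)
have Dprod : D %| \prod_(i < n.+1 | b i) adj_crit i.
  have : y ^+ 2 %| h ^+ 2 by rewrite -hE aE -mulrA dvdp_mull // dvdp_mulIl.
  rewrite dvdp_pexp2r // => /dvdpP [h1 h1E].
  apply: (@sqfree_dvdp_cofactor _ _ _ h1 D0 sqD).
  apply: (mulIf (expf_neq0 2 y0)); rewrite -exprMn -h1E -hE aE; ring.
have [lt_n|le_n] := ltnP n.+1 12.
  have D1 : size D == 1%N.
    rewrite -dvdp1 -(Gauss_dvdpl _ (_ : coprimep D (\prod_(i < n.+1 | b i) adj_crit i))).
      by rewrite mul1r.
    apply: (big_rec (coprimep D)) => [|i p _ cDp]; first exact: coprimep1.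
    rewrite coprimepMr cDp andbT.
    have /coprimepP := crit_coprime (ltn_ord i) lt_n => cop.
    apply/coprimepP => q qD qi; apply: cop; first by rewrite -dvdp_adj_crit.
    exact: dvdp_trans qD Da.
  have /size_poly1P [k _ DE] := D1.
  by apply: (@crit_not_const_sqr k n y); rewrite -DE -aE.
have le_nd : (6 <= n.+1./2)%N by lia.
have prod0 : \prod_(i < n.+1 | b i) gcdp D (adj_crit i) != 0.
  by apply/prodf_neq0 => i _; rewrite gcdp_eq0 negb_and D0.
have := dvdp_prod_gcdp Dprod; have := size_prod_gcdp_le b Da.
set G := \prod_(i < _ | _) _ in prod0 *; move=> leP /(dvdp_leq prod0).
have := @sum_min_pow2 n.+1./2 n.+1 ltac:(lia).
set S := (\sum_(_ < _) _)%N in leP *.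
have [k nE] : exists k, n = k.+2 by exists n.-2; lia.
move=> leS leD.
have [dD sD] : exists dD, size D = dD.+1.
  by exists (size D).-1; rewrite prednK // size_poly_gt0.
apply: (@sqr_twist_tower_bounded F d dD (2 ^ k * d)%N (e + g) e (v k.+1) D y) => //.
- exact: size_v.
- have : (dD <= (2 ^ (n.+1./2) + 2 ^ (n.+1 - n.+1./2).+1) * d)%N.
    apply: (@leq_trans (S * d)); last by rewrite leq_mul2r leS orbT.
    by rewrite sD in leD; move: leD leP; move: (size G) (S * d)%N => *; lia.
  have : (2 ^ (n.+1 - n.+1./2).+1 <= 2 ^ (n.+1./2 + 2))%N by rewrite leq_exp2l //; lia.
  have : (2 ^ (2 * n.+1./2 - 3) <= 2 ^ k)%N by rewrite leq_exp2l //; lia.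
  have -> : (2 * n.+1./2 - 3 = n.+1./2 + (n.+1./2 - 6) + 3)%N by lia.
  have : (64 <= 2 ^ n.+1./2)%N by rewrite (_ : 64 = 2 ^ 6)%N // leq_exp2l.
  have := expn_gt0 2 (n.+1./2 - 6).
  rewrite [(2 ^ (_ + 3))%N]expnD [(2 ^ (_ + 2))%N]expnD [(2 ^ (_ + (_ - 6)))%N]expnD.
  rewrite (_ : 2 ^ 3 = 8)%N // (_ : 2 ^ 2 = 4)%N //.
  move: (2 ^ n.+1./2)%N (2 ^ (_ - 6))%N (2 ^ k)%N (2 ^ _.+1)%N => H H' K L.
  move=> H'0 H64 HK LH dDle; have : (8 * H <= K)%N by nia.
  by nia.
- move: aE; rewrite nE /adj_crit => <-.
  by rewrite /v !orbS addrA.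
Qed.
End Orbits.

Definition ratpoly (p : {poly int}) : {poly rat} := map_poly (intr : int -> rat) p.

(** * Towers of quadratic extensions inside a field *)

Section QuadraticTowers.
Variable L : fieldType.
Implicit Types (F G : L -> Prop) (x y u r : L) (sigma : L -> L).

(** Subfields are predicates on a fixed field, so that a tower of extensions
    needs no change of type. *)
Definition subfield F :=
  [/\ F 1, forall x y, F x -> F y -> F (x - y) & forall x y, F x -> F y -> F (x / y)].

Section Closure.
Variables (F : L -> Prop) (sF : subfield F).

Lemma subf1 : F 1. Proof. by case: sF. Qed.
Lemma subfB x y : F x -> F y -> F (x - y). Proof. by case: sF => _ h _; apply: h. Qed.
Lemma subf_div x y : F x -> F y -> F (x / y). Proof. by case: sF => _ _; apply. Qed.
Lemma subf0 : F 0. Proof. by rewrite -(subrr 1); apply: subfB; apply: subf1. Qed.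
Lemma subfN x : F x -> F (- x).
Proof. by rewrite -sub0r => Fx; apply: subfB Fx; apply: subf0. Qed.
Lemma subfD x y : F x -> F y -> F (x + y).
Proof. by move=> Fx Fy; rewrite -[y]opprK; apply: subfB => //; apply: subfN. Qed.
Lemma subfV x : F x -> F x^-1.
Proof. by rewrite -div1r => Fx; apply: subf_div Fx; apply: subf1. Qed.
Lemma subfM x y : F x -> F y -> F (x * y).
Proof. by move=> Fx Fy; rewrite -[y]invrK; apply: subf_div => //; apply: subfV. Qed.
Lemma subf_sqr x : F x -> F (x ^+ 2).
Proof. by move=> Fx; rewrite expr2; apply: subfM. Qed.
Lemma subf_prod (I : eqType) (s : seq I) (P : pred I) (f : I -> L) :
  (forall i, i \in s -> F (f i)) -> F (\prod_(i <- s | P i) f i).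
Proof.
move=> Ff; rewrite big_seq_cond.
elim/big_rec: _ => [|i x /andP[/Ff Fi _] Fx]; [exact: subf1 | exact: subfM].
Qed.
End Closure.

Definition issq F u := exists2 x, F x & u = x ^+ 2.

Definition adjoin1 F r x := exists a b, [/\ F a, F b & x = a + b * r].

Lemma adjoin1_sub F r x : subfield F -> F x -> adjoin1 F r x.
Proof. by move=> sF Fx; exists x, 0; rewrite mul0r addr0; split=> //; apply: subf0. Qed.

Lemma adjoin1_gen F r : subfield F -> adjoin1 F r r.
Proof. by move=> sF; exists 0, 1; rewrite mul1r add0r; split; [apply: subf0|apply: subf1|]. Qed.

Lemma adjoin1_min F G r : subfield G -> (forall x, F x -> G x) -> G r ->
  forall x, adjoin1 F r x -> G x.
Proof.
by move=> sG FG Gr _ [a [b [Fa Fb ->]]]; apply: subfD => //; [|apply: subfM => //]; apply: FG.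
Qed.

Lemma adjoin1_inj F r a b a' b' : subfield F -> ~ F r ->
  F a -> F b -> F a' -> F b' -> a + b * r = a' + b' * r -> a = a' /\ b = b'.
Proof.
move=> sF nFr Fa Fb Fa' Fb' E.
have bb' : b = b'.
  apply: contrapT => /eqP; rewrite -subr_eq0 => bb'; apply: nFr.
  have -> : r = (a' - a) / (b - b').
    apply: (mulIf bb'); rewrite divfK //; apply: (addIr (a + b' * r)).
    by transitivity (a + b * r); [|rewrite E]; ring.
  by apply: (subf_div sF); apply: subfB.
by split=> //; apply: (addIr (b * r)); rewrite E bb'.
Qed.

Lemma adjoin1_subfield F r : subfield F -> F (r ^+ 2) -> subfield (adjoin1 F r).
Proof.
move=> sF Fr2.
have [Fr|nFr] := pselect (F r).
  have FE x : adjoin1 F r x -> F x by apply: adjoin1_min.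
  split; first exact: (adjoin1_sub _ sF (subf1 sF)).
    by move=> x y /FE Fx /FE Fy; apply: (adjoin1_sub _ sF (subfB sF _ _)).
  by move=> x y /FE Fx /FE Fy; apply: (adjoin1_sub _ sF (subf_div sF _ _)).
split; first exact: (adjoin1_sub _ sF (subf1 sF)).
  move=> _ _ [a [b [Fa Fb ->]]] [a' [b' [Fa' Fb' ->]]].
  by exists (a - a'), (b - b'); split; [apply: subfB|apply: subfB|ring].
move=> x _ [a [b [Fa Fb ->]]] [a' [b' [Fa' Fb' ->]]].
have [->|y0] := eqVneq (a' + b' * r) 0.
  by rewrite invr0 mulr0; exact: (adjoin1_sub _ sF (subf0 sF)).
have y'0 : a' - b' * r != 0.
  apply: contra_neqN y0 => /eqP E0.
  have [] := @adjoin1_inj F r a' (- b') 0 0 sF nFr => //; try exact: subf0.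
  - exact: subfN.
  - by rewrite mul0r addr0 mulNr.
  by move=> -> /eqP; rewrite oppr_eq0 => /eqP ->; rewrite mul0r addr0.
pose n := a' ^+ 2 - b' ^+ 2 * r ^+ 2.
have nE : n = (a' + b' * r) * (a' - b' * r) by rewrite /n; ring.
have Fn : F n by apply: subfB => //; do ?[by [] | apply: subf_sqr | apply: subfM].
exists ((a * a' - b * b' * r ^+ 2) / n), ((b * a' - a * b') / n); split.
- by apply: subf_div => //; apply: subfB => //; do ?[by [] | apply: subfM].
- by apply: subf_div => //; apply: subfB => //; do ?[by [] | apply: subfM].
rewrite nE; field; by rewrite y0 y'0.
Qed.

(** In [(a + b r)^2] the coefficient [2 a b] of [r] vanishes, so [a = 0] or
    [b = 0]. *)
Lemma issq_adjoin1 F r u : (2 : L) != 0 -> subfield F -> F (r ^+ 2) -> F u ->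
  issq (adjoin1 F r) u -> issq F u \/ issq F (u * r ^+ 2).
Proof.
move=> L2 sF Fr2 Fu [_ [a [b [Fa Fb ->]]] uE].
have [Fr|nFr] := pselect (F r).
  by left; exists (a + b * r) => //; apply: subfD => //; apply: subfM.
have F1 : F (a ^+ 2 + b ^+ 2 * r ^+ 2).
  by apply: subfD => //; do ?[by [] | apply: subf_sqr | apply: subfM].
have F2 : F (2 * a * b).
  by do ?[by [] | apply: subfM]; rewrite -[2]/(1 + 1); apply: subfD => //; apply: subf1.
have E0 : u + 0 * r = (a ^+ 2 + b ^+ 2 * r ^+ 2) + 2 * a * b * r by rewrite uE; ring.
have [_ /eqP] := adjoin1_inj sF nFr Fu (subf0 sF) F1 F2 E0.
rewrite eq_sym -mulrA mulf_eq0 (negPf L2) /= mulf_eq0 => /orP[] /eqP z.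
  right; exists (b * r ^+ 2); first exact: subfM.
  by rewrite uE z; ring.
by left; exists a; rewrite // uE z; ring.
Qed.

(** Homomorphisms out of a subfield are functions on the whole ambient field, of
    which only the restriction to the subfield matters. *)
Definition hom_on F sigma := [/\ sigma 1 = 1,
  forall x y, F x -> F y -> sigma (x + y) = sigma x + sigma y &
  forall x y, F x -> F y -> sigma (x * y) = sigma x * sigma y].

(** As [r] is not in [F], every element of [F(r)] is uniquely [a + b r], and
    sending it to [sigma a + sigma b * r'] is multiplicative because [r'] has the
    right square. *)
Lemma hom_on_adjoin1 F r r' sigma : subfield F -> F (r ^+ 2) -> ~ F r ->
  hom_on F sigma -> r' ^+ 2 = sigma (r ^+ 2) ->
  exists tau, [/\ hom_on (adjoin1 F r) tau, forall x, F x -> tau x = sigma x & tau r = r'].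
Proof.
move=> sF Fr2 nFr [s1 sD sM] r'E.
have s0 : sigma 0 = 0.
  by apply: (addIr (sigma 0)); rewrite -sD ?addr0 ?add0r //; apply: subf0.
(* [co x] chooses coordinates of [x] in the basis [1, r]. *)
pose P x (ab : L * L) := [/\ F ab.1, F ab.2 & x = ab.1 + ab.2 * r].
have exP x : exists ab, adjoin1 F r x -> P x ab.
  have [[a [b Pab]]|nP] := pselect (adjoin1 F r x); first by exists (a, b).
  by exists (0, 0) => /nP.
have [co coP] := choice exP.
pose tau x := sigma (co x).1 + sigma (co x).2 * r'.
have tauE a b : F a -> F b -> tau (a + b * r) = sigma a + sigma b * r'.
  move=> Fa Fb; have [|Fa' Fb' E] := coP (a + b * r); first by exists a, b.
  by rewrite /tau; have [<- <-] := adjoin1_inj sF nFr Fa Fb Fa' Fb' E.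
have F0 := subf0 sF; have F1 := subf1 sF.
have tauF x : F x -> tau x = sigma x.
  by move=> Fx; rewrite -[x in LHS]addr0 -(mul0r r) tauE // s0 mul0r addr0.
exists tau; split=> //; last first.
  by rewrite -[r in LHS]add0r -[r in LHS]mul1r tauE // s0 s1 add0r mul1r.
split; first by rewrite tauF.
  move=> _ _ [a [b [Fa Fb ->]]] [a' [b' [Fa' Fb' ->]]].
  rewrite (_ : _ + _ = (a + a') + (b + b') * r); last by ring.
  by rewrite !tauE //; do ?exact: (subfD sF); rewrite !sD //; ring.
move=> _ _ [a [b [Fa Fb ->]]] [a' [b' [Fa' Fb' ->]]].
rewrite (_ : _ * _ = (a * a' + b * b' * r ^+ 2) + (a * b' + b * a') * r); last by ring.
have Fm := subfM sF.
have Fbb : F (b * b' * r ^+ 2) by exact: Fm (Fm _ _ Fb Fb') Fr2.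
have FX := subfD sF (Fm _ _ Fa Fa') Fbb.
have FY := subfD sF (Fm _ _ Fa Fb') (Fm _ _ Fb Fa').
have sbb : sigma (b * b' * r ^+ 2) = sigma b * sigma b' * r' ^+ 2.
  by rewrite (sM (b * b')) ?(sM b) ?r'E //; apply: Fm.
rewrite tauE // tauE // tauE // (sD (a * a')) ?sbb ?sM ?(sD (a * b')) ?sM //; try exact: Fm.
by ring.
Qed.

Section Lists.
Variable rt : L -> L.
Hypothesis L2 : (2 : L) != 0.

Fixpoint adjoin F (s : seq L) : L -> Prop :=
  if s is a :: s' then adjoin (adjoin1 F (rt a)) s' else F.

Lemma adjoin_subfield F s : subfield F -> (forall a, a \in s -> F (rt a ^+ 2)) ->
  subfield (adjoin F s).
Proof.
elim: s F => [//|a s IH] F sF Fs /=.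
apply: IH => [|b bs]; first by apply: adjoin1_subfield => //; apply: Fs; rewrite mem_head.
by apply: adjoin1_sub => //; apply: Fs; rewrite inE bs orbT.
Qed.

Lemma adjoin_sub F s x : subfield F -> (forall a, a \in s -> F (rt a ^+ 2)) ->
  F x -> adjoin F s x.
Proof.
elim: s F => [//|a s IH] F sF Fs Fx /=; apply: IH; last exact: adjoin1_sub.
  by apply: adjoin1_subfield => //; apply: Fs; rewrite mem_head.
by move=> b bs; apply: adjoin1_sub => //; apply: Fs; rewrite inE bs orbT.
Qed.

Lemma adjoin_gen F s a : subfield F -> (forall a, a \in s -> F (rt a ^+ 2)) ->
  a \in s -> adjoin F s (rt a).
Proof.
elim: s F => [//|b s IH] F sF Fs /=.
have sF1 : subfield (adjoin1 F (rt b)).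
  by apply: adjoin1_subfield => //; apply: Fs; rewrite mem_head.
have Fs1 c : c \in s -> adjoin1 F (rt b) (rt c ^+ 2).
  by move=> cs; apply: adjoin1_sub => //; apply: Fs; rewrite inE cs orbT.
rewrite inE => /predU1P[->|]; last exact: IH.
by apply: adjoin_sub => //; apply: adjoin1_gen.
Qed.

Lemma adjoin_min F G s : subfield G -> (forall x, F x -> G x) ->
  (forall a, a \in s -> G (rt a)) -> forall x, adjoin F s x -> G x.
Proof.
elim: s F => [//|a s IH] F sG FG Gs /=; apply: IH => //.
  by apply: adjoin1_min => //; apply: Gs; rewrite mem_head.
by move=> b bs; apply: Gs; rewrite inE bs orbT.
Qed.

Definition sqprod s (S : pred L) := \prod_(a <- s | S a) rt a ^+ 2.

Lemma sqprod_cons a s S : a \notin s ->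
  (sqprod (a :: s) [pred x | (x != a) && S x] = sqprod s S) *
  (sqprod (a :: s) [pred x | (x == a) || S x] = rt a ^+ 2 * sqprod s S).
Proof.
move=> nas; rewrite /sqprod !big_cons /= eqxx /=; split; [|congr (_ * _)];
  rewrite big_seq_cond [RHS]big_seq_cond; apply: eq_bigl => b /=;
  by case: eqVneq => [->|]; rewrite ?(negPf nas).
Qed.

(** The part of Kummer theory that is needed: an element of [F] can become a
    square in the tower only through the adjoined roots, one step at a time. *)
Lemma issq_adjoin F s u : subfield F -> (forall a, a \in s -> F (rt a ^+ 2)) ->
  uniq s -> F u -> issq (adjoin F s) u ->
  exists S : pred L, issq F (u * sqprod s S).
Proof.
elim: s F => [|a s IH] F sF Fs /=.
  by move=> _ _ squ; exists predT; rewrite /sqprod big_nil mulr1.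
move=> /andP[nas us] Fu.
have Fa : F (rt a ^+ 2) by apply: Fs; rewrite mem_head.
have Fs' b : b \in s -> F (rt b ^+ 2) by move=> bs; apply: Fs; rewrite inE bs orbT.
move=> squ.
have [|||S] := IH (adjoin1 F (rt a)) _ _ us _ squ.
- exact: adjoin1_subfield.
- by move=> b /Fs' Fb; apply: adjoin1_sub.
- exact: adjoin1_sub.
move=> h; have Fp : F (u * sqprod s S) by apply: subfM => //; apply: subf_prod.
have [{}h|{}h] := issq_adjoin1 L2 sF Fa Fp h.
  by exists [pred x | (x != a) && S x]; rewrite (sqprod_cons S nas).
exists [pred x | (x == a) || S x]; rewrite (sqprod_cons S nas).
by rewrite [rt a ^+ 2 * _]mulrC mulrA.
Qed.

Definition sq_indep F s := forall S : pred L, has S s -> ~ issq F (sqprod s S).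

(** Independence modulo squares keeps every new root outside the field built so
    far, and persists after adjoining one root, by [issq_adjoin1]. *)
Lemma hom_on_adjoin F s sigma (r' : L -> L) :
  subfield F -> (forall a, a \in s -> F (rt a ^+ 2)) -> uniq s -> sq_indep F s ->
  hom_on F sigma -> (forall a, a \in s -> r' a ^+ 2 = sigma (rt a ^+ 2)) ->
  exists tau, [/\ hom_on (adjoin F s) tau, forall x, F x -> tau x = sigma x &
                  forall a, a \in s -> tau (rt a) = r' a].
Proof.
elim: s F sigma => [|a s IH] F sigma sF Fs /=; first by exists sigma.
move=> /andP[nas us] indF hF r'E.
have Fa : F (rt a ^+ 2) by apply: Fs; rewrite mem_head.
have Fs' b : b \in s -> F (rt b ^+ 2) by move=> bs; apply: Fs; rewrite inE bs orbT.
have nFa : ~ F (rt a).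
  move=> Fra; apply: (indF (pred1 a)); first by rewrite /= eqxx.
  exists (rt a) => //; rewrite /sqprod big_cons /= eqxx big_seq_cond big1 ?mulr1 //.
  by move=> b /andP[bs /eqP ba]; rewrite -ba bs in nas.
have [|tau1 [h1 t1F t1a]] := @hom_on_adjoin1 F (rt a) (r' a) sigma sF Fa nFa hF.
  by apply: r'E; rewrite mem_head.
have [|||S hS|||tau [h tF ts]] := IH (adjoin1 F (rt a)) tau1.
- exact: adjoin1_subfield.
- by move=> b /Fs' Fb; apply: adjoin1_sub.
- by [].
- move=> h; have Fp : F (sqprod s S) by apply: subf_prod.
  have [] := issq_adjoin1 L2 sF Fa Fp h.
    rewrite -[sqprod s S](sqprod_cons S nas); apply: indF.
    apply/hasP; have /hasP [b bs Sb] := hS; exists b; rewrite ?inE ?bs ?orbT //=.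
    by rewrite Sb andbT; apply: contraNneq nas => <-.
  rewrite [_ * rt a ^+ 2]mulrC -(sqprod_cons S nas).2; apply: indF => /=.
  by rewrite eqxx.
- by [].
- by move=> b bs; rewrite t1F ?r'E ?inE ?bs ?orbT //; apply: Fs'.
exists tau; split=> //.
  by move=> x Fx; rewrite tF ?t1F //; apply: adjoin1_sub.
move=> b; rewrite inE => /predU1P[->|]; last exact: ts.
by rewrite tF ?t1a //; apply: adjoin1_gen.
Qed.
End Lists.
End QuadraticTowers.

(** * The tower of iterated preimages of a quadratic polynomial *)

Section PreimageTower.
Variables (K L : fieldType) (iota : {rmorphism K -> L}) (g c : K) (rt : L -> L).
Hypotheses (L2 : (2 : L) != 0) (rtE : forall a, rt a ^+ 2 = a - iota c).

Definition qmap (F : comNzRingType) (g c x : F) : F := (x - g) ^+ 2 + c.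

Let f : L -> L := qmap (iota g) (iota c).

Fixpoint preim_seq n : seq L :=
  if n is n'.+1 then [seq iota g + s * rt a | a <- preim_seq n', s <- [:: 1; -1]]
  else [:: 0].
Local Notation Rs := preim_seq.
Arguments preim_seq : simpl never.

Fixpoint preim_field n : L -> Prop :=
  if n is n'.+1 then adjoin rt (preim_field n') (Rs n')
  else fun x => exists a, x = iota a.
Local Notation Kt := preim_field.

Lemma preim_seqS n :
  Rs n.+1 = [seq iota g + s * rt a | a <- Rs n, s <- [:: 1; -1]].
Proof. by []. Qed.

Lemma mem_preim_seqS b n : (b \in Rs n.+1) = (f b \in Rs n).
Proof.
apply/idP/idP => [/allpairsP[[a s] /= [aR s1 ->]]|fbR].
  suff -> : f (iota g + s * rt a) = a by [].
  rewrite /f /qmap addrAC subrr add0r exprMn rtE.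
  have -> : s ^+ 2 = 1 by move: s1; rewrite !inE => /orP[] /eqP ->; rewrite ?sqrrN expr1n.
  by rewrite mul1r subrK.
have : (b - iota g) ^+ 2 == rt (f b) ^+ 2 by rewrite rtE /f /qmap addrK.
rewrite eqf_sqr => bE; apply/allpairsP.
exists (f b, if b - iota g == rt (f b) then 1 else -1); split=> //=.
  by rewrite !inE; case: ifP; rewrite eqxx ?orbT.
case: eqP bE => [<- _|_ /= /eqP bE]; first by rewrite mul1r subrKC.
by rewrite mulN1r -bE subrKC.
Qed.

Lemma preim_field_gens n : [/\ subfield (Kt n), forall a, Kt n (iota a) &
  forall a, a \in Rs n -> Kt n a].
Proof.
elim: n => [|n [sK Ki KR]].
  split.
  - split; first by exists 1; rewrite rmorph1.
      by move=> _ _ [a ->] [b ->]; exists (a - b); rewrite rmorphB.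
    by move=> _ _ [a ->] [b ->]; exists (a / b); rewrite fmorph_div.
  - by move=> a; exists a.
  - by move=> a; rewrite inE => /eqP ->; exists 0; rewrite rmorph0.
have Krt a : a \in Rs n -> Kt n (rt a ^+ 2).
  by move=> /KR Ka; rewrite rtE; apply: (subfB sK).
have sK1 : subfield (Kt n.+1) by apply: adjoin_subfield.
have Kin x : Kt n x -> Kt n.+1 x by apply: adjoin_sub.
split=> // [a|_ /allpairsP[[a s] /= [aR s1 ->]]]; first exact: Kin.
apply: (subfD sK1); first exact: Kin.
have Ka : Kt n.+1 (rt a) by apply: adjoin_gen.
move: s1; rewrite !inE => /orP[] /eqP ->; rewrite ?mulN1r ?mul1r //.
exact: subfN.
Qed.

Lemma preim_subfield n : subfield (Kt n). Proof. by case: (preim_field_gens n). Qed.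
Lemma preim_field_base n a : Kt n (iota a). Proof. by case: (preim_field_gens n). Qed.
Lemma preim_field_root n a : a \in Rs n -> Kt n a.
Proof. by case: (preim_field_gens n) => _ _; apply. Qed.
Lemma preim_field_rt2 n a : a \in Rs n -> Kt n (rt a ^+ 2).
Proof.
move=> aR; rewrite rtE; apply: (subfB (preim_subfield n)).
  exact: preim_field_root.
exact: preim_field_base.
Qed.
Lemma preim_fieldS n x : Kt n x -> Kt n.+1 x.
Proof. by apply: adjoin_sub; [apply: preim_subfield|apply: preim_field_rt2]. Qed.
Lemma preim_field_rt n a : a \in Rs n -> Kt n.+1 (rt a).
Proof. by apply: adjoin_gen; [apply: preim_subfield|apply: preim_field_rt2]. Qed.
Lemma preim_field_le m n x : (m <= n)%N -> Kt m x -> Kt n x.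
Proof.
move=> /subnKC <-; elim: (n - m)%N => [|k IH] Kx; first by rewrite addn0.
by rewrite addnS; apply/preim_fieldS/IH.
Qed.

Definition base_hom n sigma := hom_on (Kt n) sigma /\ forall a, sigma (iota a) = iota a.

Lemma base_homB n sigma x y : base_hom n sigma -> Kt n x -> Kt n y ->
  sigma (x - y) = sigma x - sigma y.
Proof.
move=> [[s1 sD sM] _] Kx Ky; apply: (addIr (sigma y)).
by rewrite -sD ?subrK //; apply: (subfB (preim_subfield n)).
Qed.

Lemma base_homX2 n sigma x : base_hom n sigma -> Kt n x -> sigma (x ^+ 2) = sigma x ^+ 2.
Proof. by move=> [[s1 sD sM] _] Kx; rewrite !expr2 sM. Qed.

Lemma base_hom_le m n sigma : (m <= n)%N -> base_hom n sigma -> base_hom m sigma.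
Proof.
move=> mn [[s1 sD sM] si]; split=> //; split=> // x y Kx Ky;
  [apply: sD | apply: sM]; exact: (preim_field_le mn).
Qed.

Lemma base_hom_root n sigma a : base_hom n sigma -> a \in Rs n -> sigma a \in Rs n.
Proof.
elim: n sigma a => [|n IH] sigma a hs.
  by rewrite !inE => /eqP ->; rewrite -(rmorph0 iota) hs.2.
move=> aR; have Ka := preim_field_root aR.
have sK := preim_subfield n.+1; have Kc := preim_field_base n.+1 c.
have Kg := preim_field_base n.+1 g.
move: aR; rewrite !mem_preim_seqS => /(IH sigma); rewrite /f /qmap.
have [[_ sD _] si] := hs.
rewrite sD ?(base_homX2 hs) ?(base_homB hs) // ?si; last 2 first.
- exact: subfB.
- by apply: subf_sqr => //; apply: subfB.
by apply; apply: base_hom_le hs.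
Qed.

(** The [n]-th field is generated by the roots of level [n] alone, since the
    lower levels are their images under the polynomial. *)
Lemma preim_field_min n (G : L -> Prop) : subfield G -> (forall a, G (iota a)) ->
  (forall b, b \in Rs n -> G b) -> forall x, Kt n x -> G x.
Proof.
move=> sG Gi; elim: n => [|n IH] GR; first by move=> _ [a ->].
have Gb a : a \in Rs n -> G (iota g + 1 * rt a).
  move=> aR; apply: GR; apply/allpairsP; exists (a, 1); split=> //.
  by rewrite inE eqxx.
apply: adjoin_min => // [|a aR].
  apply: IH => a aR; have := Gb a aR; rewrite mul1r => Gba.
  have -> : a = f (iota g + rt a).
    by rewrite /f /qmap addrAC subrr add0r rtE subrK.
  by apply: (subfD sG) => //; apply: subf_sqr => //; apply: subfB.
by have := subfB sG (Gb a aR) (Gi g); rewrite mul1r addrAC subrr add0r.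
Qed.

Lemma base_hom_stable n sigma x : base_hom n sigma -> Kt n x -> Kt n (sigma x).
Proof.
move=> hs Kx; have sK := preim_subfield n; have [[s1 sD sM] si] := hs.
suff [] : Kt n x /\ Kt n (sigma x) by [].
move: x Kx; apply: (@preim_field_min n (fun x => Kt n x /\ Kt n (sigma x))).
- split; first by rewrite s1; split; apply: (subf1 sK).
    by move=> x y [Kx Kx'] [Ky Ky']; rewrite (base_homB hs) //; split; apply: (subfB sK).
  move=> x y [Kx Kx'] [Ky Ky']; split; first exact: (subf_div sK).
  have [->|y0] := eqVneq y 0.
    by rewrite invr0 mulr0 -(rmorph0 iota) si; apply: preim_field_base.
  have KV : Kt n y^-1 by apply: (subfV sK).
  have sy : sigma y * sigma y^-1 = 1 by rewrite -sM // mulfV.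
  have sy0 : sigma y != 0.
    by apply: contraNneq (oner_neq0 L) => sy0; rewrite -sy sy0 mul0r.
  rewrite sM //; apply: (subfM sK) => //.
  by rewrite -[sigma _](mulKf sy0) sy mulr1; apply: (subfV sK).
- by move=> a; rewrite si; split; apply: preim_field_base.
by move=> b bR; split; apply: preim_field_root => //; apply: base_hom_root bR.
Qed.

Lemma base_hom_prod n sigma (s : seq L) (P : pred L) (h : L -> L) : base_hom n sigma ->
  (forall i, i \in s -> Kt n (h i)) ->
  sigma (\prod_(i <- s | P i) h i) = \prod_(i <- s | P i) sigma (h i).
Proof.
move=> [[s1 sD sM] si]; have sK := preim_subfield n.
elim: s => [|a s IH] Kh; first by rewrite !big_nil.
have Kh' i : i \in s -> Kt n (h i) by move=> is_; apply: Kh; rewrite inE is_ orbT.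
rewrite !big_cons; case: ifP => _; last exact: IH.
rewrite sM ?IH //; first by apply: Kh; rewrite mem_head.
exact: subf_prod.
Qed.

Definition indep n := sq_indep rt (Kt n) (Rs n).

Lemma indep_rt_neq0 n a : indep n -> a \in Rs n -> rt a != 0.
Proof.
move=> ind aR; apply/eqP => ra0; apply: (ind (pred1 a)).
  by apply/hasP; exists a => //=.
exists 0; first exact: (subf0 (preim_subfield n)).
rewrite /sqprod expr0n /=; apply/eqP; rewrite prodf_seq_eq0; apply/hasP.
by exists a; rewrite //= eqxx ra0 expr0n eqxx.
Qed.

Lemma uniq_preim_seq n : (forall j, (j < n)%N -> indep j) -> uniq (Rs n).
Proof.
elim: n => [//|n IH] ind.
apply: (@allpairs_uniq _ _ _ (fun a s => iota g + s * rt a)).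
- by apply: IH => j jn; apply: ind; apply: ltnW.
- rewrite /= inE andbT; apply: contra_neqN L2 => /eqP h.
  by rewrite -[2]/(1 + 1) {1}h addNr.
move=> [a s] [a' s'] /allpairsP[[a1 s1] [aR sR [-> ->]]].
move=> /allpairsP[[a2 s2] [aR' sR' [-> ->]]] /addrI /= E.
move: aR sR aR' sR' => /= aR sR aR' sR'.
have sq1 (t : L) : t \in [:: 1; -1] -> t ^+ 2 = 1.
  by rewrite !inE => /orP[] /eqP ->; rewrite ?sqrrN expr1n.
have aa : a1 = a2.
  have : (s1 * rt a1) ^+ 2 = (s2 * rt a2) ^+ 2 by rewrite E.
  by rewrite !exprMn (sq1 s1) // (sq1 s2) // !mul1r !rtE => /addIr.
by move: E; rewrite aa => /(mulIf (indep_rt_neq0 (ind n (leqnn _)) aR')) ->.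
Qed.

Lemma base_hom_extS n sigma (eps : L -> bool) :
    uniq (Rs n) -> indep n -> base_hom n sigma ->
  exists tau, [/\ base_hom n.+1 tau, forall x, Kt n x -> tau x = sigma x &
    forall a, a \in Rs n -> tau (rt a) = (-1) ^+ eps a * rt (sigma a)].
Proof.
move=> uR ind hs; have [hK si] := hs.
have [|tau [h1 h2 h3]] := @hom_on_adjoin L rt L2 (Kt n) (Rs n) sigma
  (fun a => (-1) ^+ eps a * rt (sigma a)) (preim_subfield n) (@preim_field_rt2 n) uR ind hK.
  move=> a aR; rewrite exprMn sqrr_sign mul1r !rtE (base_homB hs) ?si //.
    exact: preim_field_root.
  exact: preim_field_base.
exists tau; split=> //; split=> // a.
by rewrite h2 //; apply: preim_field_base.
Qed.

Lemma base_hom_ext m n sigma : (m <= n)%N -> (forall j, (j < n)%N -> indep j) ->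
  base_hom m sigma -> exists2 tau, base_hom n tau & forall x, Kt m x -> tau x = sigma x.
Proof.
move=> /subnKC <-; elim: (n - m)%N => [|k IH] ind hs.
  by rewrite addn0; exists sigma.
rewrite addnS in ind *.
have [|tau ht tm] := IH _ hs; first by move=> j jk; apply: ind; apply: ltnW.
have [||tau' [ht' tt _]] := @base_hom_extS (m + k) tau xpred0 _ _ ht.
- by apply: uniq_preim_seq => j jk; apply: ind; apply: ltnW.
- exact: ind.
by exists tau' => // x Kx; rewrite tt ?tm //; apply: preim_field_le Kx; rewrite leq_addr.
Qed.

(** Extends the identity of the [m]-th field by changing the sign of [rt a] alone;
    on the tree this exchanges the two children of [a]. *)
Lemma base_hom_swap m n a : (m < n)%N -> (forall j, (j < n)%N -> indep j) ->
  exists sigma, [/\ base_hom n sigma, forall x, Kt m x -> sigma x = x &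
    forall b, b \in Rs m -> sigma (rt b) = (-1) ^+ (b == a) * rt b].
Proof.
move=> mn ind.
have h0 : base_hom m id by [].
have [||sigma [hs sid sa]] := @base_hom_extS m id (fun b => b == a) _ _ h0.
- by apply: uniq_preim_seq => j jm; apply: ind; apply: ltn_trans mn.
- exact: ind.
have [tau ht ts] := base_hom_ext mn ind hs.
exists tau; split=> // [x Kx|b bR].
  by rewrite ts ?sid //; apply: preim_fieldS.
by rewrite ts ?sa //; apply: preim_field_rt.
Qed.

(** For [m < n] this is the product of [beta - c] over the roots [beta] of level
    [n] above the root [a] of level [m], see [factor_pair]; at [m = n] the sign
    is opposite to that of the general formula. *)
Definition factor n m a :=
  if m == n then a - iota c else iter (n - m) f (iota c) - a.

Lemma factor_pair n m a : (m < n)%N ->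
  factor n m.+1 (iota g + 1 * rt a) * factor n m.+1 (iota g + -1 * rt a) = factor n m a.
Proof.
move=> mn; rewrite /factor (ltn_eqF mn) mul1r mulN1r.
have aE : a = rt a ^+ 2 + iota c by rewrite rtE subrK.
case: eqP => [<-|_]; first by rewrite subSnn /= /f /qmap [X in _ = _ - X]aE; ring.
have -> : (n - m = (n - m.+1).+1)%N by lia.
by rewrite iterS; move: (iter _ _ _) => t; rewrite /f /qmap [X in _ = _ - X]aE; ring.
Qed.

Definition fprod n m (S : pred L) := \prod_(a <- Rs m | S a) factor n m a.

Definition wpair n m (S : pred L) a :=
  (if S (iota g + 1 * rt a) then factor n m.+1 (iota g + 1 * rt a) else 1) *
  (if S (iota g + -1 * rt a) then factor n m.+1 (iota g + -1 * rt a) else 1).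

Lemma fprodS n m S : fprod n m.+1 S = \prod_(a <- Rs m) wpair n m S a.
Proof.
rewrite /fprod big_mkcond /= big_allpairs_dep; apply: eq_bigr => a _.
by rewrite !big_cons big_nil /= mulr1.
Qed.

Lemma issq_mul_sqr (F : L -> Prop) u y : subfield F -> F y -> y != 0 ->
  issq F (u * y ^+ 2) -> issq F u.
Proof.
move=> sF Fy y0 [x Fx E]; exists (x / y); first exact: subf_div.
by rewrite expr_div_n -E mulfK // expf_neq0.
Qed.

Lemma factor_in n m a : (m <= n)%N -> a \in Rs m -> Kt n (factor n m a).
Proof.
move=> mn aR; have sK := preim_subfield n.
have Ka : Kt n a by apply: (preim_field_le mn); apply: preim_field_root.
have Kc := preim_field_base n c; rewrite /factor; case: eqP => _; first exact: subfB.
apply: subfB => //; elim: (n - m)%N => [//|k Kk]; rewrite iterS.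
apply: (subfD sK) => //; apply: subf_sqr => //; apply: subfB => //.
exact: preim_field_base.
Qed.

(** Let [sigma] exchange the two children of one vertex [a]. If exactly one of
    them occurs in the relation, multiplying the relation by its image under
    [sigma] leaves the factor of [a] alone, up to squares, which is excluded. So
    children occur in pairs, and the relation comes from level [m]. *)
Lemma fprod_descend n m u (S : pred L) : (m < n)%N -> (forall j, (j < n)%N -> indep j) ->
    (forall a, a \in Rs m -> ~ issq (Kt n) (factor n m a)) -> u != 0 ->
    issq (Kt n) (iota u * fprod n m.+1 S) ->
  exists S' : pred L, issq (Kt n) (iota u * fprod n m S') /\
    (has S (Rs m.+1) -> has S' (Rs m)).
Proof.
move=> mn ind nsq u0 sq.
have sK := preim_subfield n.
have iu0 : iota u != 0 by rewrite fmorph_eq0.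
have [/allP same|/allPn [a aR diff]] :=
  boolP (all (fun a => S (iota g + 1 * rt a) == S (iota g + -1 * rt a)) (Rs m)).
  exists (fun a => S (iota g + 1 * rt a)); split.
    move: sq; rewrite fprodS /fprod [\prod_(_ <- _ | S _) _]big_mkcond /=.
    congr (issq _ (_ * _)); rewrite !big_seq; apply: eq_bigr => b bR.
    rewrite /wpair -(eqP (same b bR)); case: ifP; rewrite ?mulr1 // => _.
    exact: factor_pair.
  move=> /hasP[_ /allpairsP[[b s] /= [bR sR ->]]] Sb; apply/hasP; exists b => //.
  by move: sR Sb; rewrite !inE => /orP[] /eqP -> //; rewrite (eqP (same b bR)).
have [sigma [hs sid srt]] := base_hom_swap a mn ind.
have [[s1 sD sM] si] := hs.
have [x Kx xE] := sq.
have wK (b : L) : b \in Rs m -> Kt n (wpair n m S b).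
  move=> bR; have memb s : s \in [:: 1; -1] -> iota g + s * rt b \in Rs m.+1.
    by move=> s1'; apply/allpairsP; exists (b, s).
  by apply: (subfM sK); case: ifP => _; try exact: subf1;
     apply: factor_in => //; apply: memb; rewrite !inE eqxx ?orbT.
have memb b s : b \in Rs m -> s \in [:: 1; -1] -> iota g + s * rt b \in Rs m.+1.
  by move=> bR s1'; apply/allpairsP; exists (b, s).
have one_in : 1 \in [:: 1; -1 : L] by rewrite inE eqxx.
have mone_in : -1 \in [:: 1; -1 : L] by rewrite !inE eqxx orbT.
have Kg := preim_field_base n g.
have Krt b : b \in Rs m -> Kt n (rt b).
  by move=> bR; apply: (preim_field_le mn); apply: preim_field_rt.
have sfac b : b \in Rs m.+1 -> sigma (factor n m.+1 b) = factor n m.+1 (sigma b).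
  move=> bR; have Kb : Kt n b by apply: (preim_field_le mn); apply: preim_field_root.
  have Kc := preim_field_base n c.
  rewrite /factor; case: eqP => _; first by rewrite (base_homB hs) ?si.
  have iterE k : Kt n (iter k f (iota c)) /\ sigma (iter k f (iota c)) = iter k f (iota c).
    have -> : iter k f (iota c) = iota (iter k (qmap g c) c).
      elim: k => [//|k IH]; rewrite !iterS IH /f /qmap.
      by rewrite rmorphD rmorphXn rmorphB.
    by split; [apply: preim_field_base|apply: si].
  by rewrite (base_homB hs) ?(iterE _).2 //; case: (iterE (n - m.+1)%N).
have sch b s : b \in Rs m -> s \in [:: 1; -1] ->
    sigma (iota g + s * rt b) = iota g + s * sigma (rt b).
  move=> bR; rewrite !inE => /orP[] /eqP ->; rewrite ?mul1r ?mulN1r.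
    by rewrite sD ?si //; apply: Krt.
  by rewrite (base_homB hs) ?si //; apply: Krt.
have sw b : b \in Rs m -> b != a -> sigma (wpair n m S b) = wpair n m S b.
  move=> bR ba; rewrite /wpair sM; try by case: ifP => _; [apply: factor_in => //; apply: memb | apply: (subf1 sK)].
  by rewrite !(fun_if sigma (S _)) s1 !sfac ?memb // !sch // srt // (negPf ba) expr0 !mul1r.
have swa : wpair n m S a * sigma (wpair n m S a) = factor n m a.
  rewrite /wpair sM; try by case: ifP => _; [apply: factor_in => //; apply: memb | apply: (subf1 sK)].
  rewrite !(fun_if sigma (S _)) s1 !sfac ?memb // !sch // srt // eqxx expr1 -(factor_pair a mn).
  have -> : 1 * (-1 * rt a) = -1 * rt a by rewrite mul1r.
  have -> : -1 * (-1 * rt a) = 1 * rt a by rewrite mulN1r mulN1r opprK mul1r.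
  by move: diff; case: (S _); case: (S _) => // _; rewrite ?mul1r ?mulr1 // mulrC.
exfalso; apply: (nsq a aR).
(* [Y] collects what the relation and its image have in common. *)
pose Y := iota u * \prod_(b <- Rs m | b != a) wpair n m S b.
have uR : uniq (Rs m).
  by apply: uniq_preim_seq => j jm; apply: ind; apply: ltn_trans mn.
have KY : Kt n Y.
  by apply: (subfM sK); [apply: preim_field_base|apply: (subf_prod sK)].
apply: (@issq_mul_sqr _ _ Y) => //.
  rewrite mulf_neq0 //; rewrite prodf_seq_neq0; apply/allP => b bR; apply/implyP => _.
  have : factor n m.+1 (iota g + 1 * rt b) * factor n m.+1 (iota g + -1 * rt b) != 0.
    rewrite factor_pair //; apply/eqP => f0; apply: (nsq b bR); rewrite f0.
    by exists 0; [apply: (subf0 sK)|rewrite expr0n].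
  rewrite mulf_eq0 negb_or /wpair => /andP[n1 n2].
  by rewrite mulf_neq0 //; case: ifP => // _; apply: oner_neq0.
exists (x * sigma x).
  by apply: (subfM sK) => //; apply: base_hom_stable hs Kx.
have KP : Kt n (\prod_(b <- Rs m | b != a) wpair n m S b) by apply: (subf_prod sK).
have sP : sigma (\prod_(b <- Rs m | b != a) wpair n m S b) =
          \prod_(b <- Rs m | b != a) wpair n m S b.
  rewrite (base_hom_prod _ hs) // big_seq_cond [RHS]big_seq_cond.
  by apply: eq_bigr => b /andP[bR ba]; apply: sw.
rewrite [RHS]exprMn -(base_homX2 hs Kx) -xE fprodS (bigD1_seq a) //=.
have Kw := wK a aR; move: sP KP @Y KY; set P := \prod_(b <- _ | _) _ => sP KP Y KY.
rewrite (sM (iota u)) ?si ?(sM (wpair n m S a)) // ?sP -?swa; last exact: (subfM sK).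
  by rewrite /Y; ring.
exact: preim_field_base.
Qed.

Lemma has_pred1 (T : eqType) (s : seq T) a : a \in s -> has (pred1 a) s.
Proof. by move=> aR; apply/hasP; exists a => //=. Qed.

Lemma fprod_nsq n : (forall j, (j < n)%N -> indep j) -> ~ issq (Kt n) (factor n 0 0) ->
  forall m, (m <= n)%N -> forall S : pred L, has S (Rs m) -> ~ issq (Kt n) (fprod n m S).
Proof.
move=> ind base; elim=> [_ S|m IH mn S hS].
  by rewrite /= orbF => S0; rewrite /fprod big_cons S0 big_nil mulr1.
rewrite -[fprod _ _ _]mul1r -(rmorph1 iota) => sq.
have [||S' []] := fprod_descend mn ind _ _ sq.
- move=> a aR; have := IH (ltnW mn) (pred1 a) (has_pred1 aR).
  have uR : uniq (Rs m).
    by apply: uniq_preim_seq => j jm; apply: ind; apply: ltn_trans mn.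
  by rewrite /fprod -big_filter filter_pred1_uniq ?big_seq1 //.
- exact: oner_neq0.
rewrite rmorph1 mul1r => sq' /(_ hS) hS'.
exact: IH (ltnW mn) S' hS' sq'.
Qed.

Lemma sqprod_fprod n (S : pred L) : sqprod rt (Rs n) S = fprod n n S.
Proof. by apply: eq_bigr => a _; rewrite /factor eqxx rtE. Qed.

(** The counterpart of [adj_crit] in the base field, before the translation by
    [g]. *)
Definition crit_val n := if n is 0 then - c else iter n (qmap g c) c.

Lemma factor_crit n : factor n 0 0 = iota (crit_val n).
Proof.
rewrite /factor; case: n => [|n] /=; first by rewrite sub0r rmorphN.
rewrite subr0 /f -!iterS; elim: n.+1 => [//|k IH]; rewrite !iterS IH /qmap.
by rewrite rmorphD rmorphXn rmorphB.
Qed.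

(** Kummer theory turns a square of level [k + 1] into a relation at the top of
    level [k]; [fprod_descend] brings it down to the root of the tree, whose
    factor is the critical value. *)
Lemma issq_descend k u : (forall j, (j <= k)%N -> indep j) -> ~ issq (Kt k) (factor k 0 0) ->
    u != 0 -> issq (Kt k.+1) (iota u) ->
  exists b : bool, issq (Kt k) (iota (u * (if b then crit_val k else 1))).
Proof.
move=> ind base u0 sq.
have ind' j : (j < k)%N -> indep j by move=> jk; apply: ind; apply: ltnW.
have uR m : (m <= k)%N -> uniq (Rs m).
  by move=> mk; apply: uniq_preim_seq => j jm; apply: ind; apply: leq_trans (ltnW jm) mk.
have [S] := issq_adjoin L2 (preim_subfield k) (@preim_field_rt2 k) (uR k (leqnn _))
  (preim_field_base k u) sq.
rewrite sqprod_fprod => {}sq.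
have {S sq} [S sq] : exists S, issq (Kt k) (iota u * fprod k 0 S).
  have : forall m, (m <= k)%N -> exists S, issq (Kt k) (iota u * fprod k (k - m) S).
    elim=> [_|m IH mk]; first by exists S; rewrite subn0.
    have [S1 sq1] := IH (ltnW mk).
    have kmE : (k - m = (k - m.+1).+1)%N by lia.
    rewrite kmE in sq1; have lt_m : (k - m.+1 < k)%N by lia.
    have [|S2 [sq2 _]] := fprod_descend lt_m ind' _ u0 sq1; last by exists S2.
    move=> a aR; have := fprod_nsq ind' base (ltnW lt_m) (has_pred1 aR).
    by rewrite /fprod -big_filter filter_pred1_uniq ?big_seq1 // uR // ltnW.
  by move/(_ k (leqnn _)); rewrite subnn.
exists (S 0); move: sq; rewrite /fprod big_cons big_nil rmorphM.
by case: (S 0); rewrite ?rmorph1 // mulr1 factor_crit.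
Qed.

Hypothesis crit_indep : forall n (b : pred nat) x,
  crit_val n * \prod_(i < n | b i) crit_val i <> x ^+ 2.

Lemma crit_val_neq0 n : crit_val n != 0.
Proof.
apply/eqP => c0; apply: (@crit_indep n pred0 0).
by rewrite c0 mul0r expr0n.
Qed.

Lemma issq_base k u : (forall j, (j < k)%N -> indep j) ->
    (forall j, (j < k)%N -> ~ issq (Kt j) (factor j 0 0)) ->
    u != 0 -> issq (Kt k) (iota u) ->
  exists b : pred nat, issq (Kt 0) (iota (u * \prod_(i < k | b i) crit_val i)).
Proof.
elim: k u => [|k IH] u ind base u0 sq.
  by exists pred0; rewrite big_ord0 mulr1.
have [b0 sq1] := issq_descend ind (base k (leqnn _)) u0 sq.
have [|||b sqb] := IH _ _ _ _ sq1.
- by move=> j jk; apply: ind; apply: ltnW.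
- by move=> j jk; apply: base; apply: ltnW.
- by rewrite mulf_neq0 //; case: b0 {sq1}; rewrite ?crit_val_neq0 ?oner_neq0.
exists (fun i => if i == k then b0 else b i); move: sqb; congr (issq _ (iota _)).
rewrite big_mkcond [in RHS]big_mkcond big_ord_recr /= eqxx -mulrA; congr (_ * _).
rewrite mulrC; congr (_ * _); apply: eq_bigr => i _.
by rewrite (ltn_eqF (ltn_ord i)).
Qed.

(** Strong induction on [n]: independence below [n] provides the automorphisms
    used in [fprod_descend] at level [n], and, through [issq_base], reduces the
    squares of [K] in the [n]-th field to squares in [K]. *)
Theorem indep_all n : indep n /\ ~ issq (Kt n) (factor n 0 0).
Proof.
have [N] := ubnP n; elim: N n => // N IH n; rewrite ltnS => le_n.
have ind j : (j < n)%N -> indep j by move=> jn; case: (IH j) => //; apply: leq_trans le_n.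
have base j : (j < n)%N -> ~ issq (Kt j) (factor j 0 0).
  by move=> jn; case: (IH j) => //; apply: leq_trans le_n.
have basen : ~ issq (Kt n) (factor n 0 0).
  rewrite factor_crit => /(issq_base ind base (crit_val_neq0 n)) [b [_ [x ->]]].
  by rewrite -rmorphXn => /(fmorph_inj iota) /crit_indep.
split=> // S hS; rewrite sqprod_fprod; exact: fprod_nsq.
Qed.

End PreimageTower.
Arguments preim_seq : simpl never.

(** * Tree automorphisms come from the Galois group *)

Section TreeAut.
Variables (K L : fieldType) (iota : {rmorphism K -> L}) (phi : {poly K}).
Local Notation vertex := (vertex iota phi).
Local Notation level := (@Defs.level K L iota phi).
Local Notation point := (@Defs.point K L iota phi).
Local Notation parent_of := (@parent_of K L iota phi).

Lemma vertex_eq (v w : vertex) : level v = level w -> point v = point w -> v = w.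
Proof.
case: v w => [[n x] h] [[m y] h']; rewrite /Defs.level /Defs.point /= => nm xy.
by apply: val_inj => /=; rewrite nm xy.
Qed.

Lemma iter_root_parent n x : iter_root iota phi n.+1 x ->
  iter_root iota phi n (map_poly iota phi).[x].
Proof. by rewrite /iter_root /= map_comp_poly /root horner_comp. Qed.

Lemma parent_exists (v : vertex) n : level v = n.+1 -> exists w, parent_of w v.
Proof.
case: v => [[m x] /= h]; rewrite /Defs.level /= => mn; subst m.
exists (exist _ (n, (map_poly iota phi).[x]) (iter_root_parent h)).
by rewrite /Defs.parent_of /Defs.level /Defs.point /= !eqxx.
Qed.

Lemma parent_unique v w w' : parent_of w v -> parent_of w' v -> w = w'.
Proof.
move=> /andP[/eqP l1 /eqP p1] /andP[/eqP l2 /eqP p2]; apply: vertex_eq.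
  by move: l2; rewrite l1 => -[].
by rewrite p1 p2.
Qed.

(** A graph automorphism fixing the root preserves levels: a child of [w] must go
    to a neighbour of [s w], and the only neighbour that is not a child of [s w]
    is its parent, already the image of the parent of [w]. *)
Lemma tree_aut_level s : @tree_aut K L iota phi s -> forall n v, level v = n ->
  level (s v) = n /\ forall w, parent_of w v -> parent_of (s w) (s v).
Proof.
move=> [bs s0 sadj]; elim/ltn_ind => n IH v lv.
case: n => [|n] in IH lv *.
  have -> : v = tree_root iota phi.
    apply: vertex_eq; first by rewrite lv.
    have := valP v; rewrite /= -/(level v) lv /iter_root /= map_polyX.
    by rewrite /root hornerX => /eqP.
  rewrite s0; split=> // w /andP[/eqP]; by rewrite {1}/Defs.level /=.
have [w0 pw0] := parent_exists lv.
have lw0 : level w0 = n by case/andP: (pw0); rewrite lv => /eqP [].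
have adj : Defs.adjacent (s w0) (s v) by rewrite sadj /Defs.adjacent pw0.
have [ls0 ps0] := IH n (ltnSn n) w0 lw0.
case/orP: adj => [psv|psw].
  split; first by case/andP: psv; rewrite ls0 => /eqP.
  by move=> w pw; rewrite (parent_unique pw pw0).
have [m nE] : exists m, n = m.+1.
  by case/andP: psw; rewrite ls0 => /eqP ->; eexists.
have [w1 pw1] := parent_exists (etrans lw0 nE).
have sv : s v = s w1 by apply: parent_unique psw (ps0 w1 pw1).
have vw : v = w1 by apply: (bij_inj bs).
by move: pw1; rewrite -vw => /andP[/eqP]; rewrite lw0 lv; lia.
Qed.
End TreeAut.

Lemma divring_closedP (L : fieldType) (S : set L) :
  GRing.divring_closed [in S] <-> subfield S.
Proof.
rewrite /GRing.divring_closed /subfield; split=> -[h1 hB hD].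
  split; first by move: h1; rewrite inE.
    by move=> x y Sx Sy; have := hB x y; rewrite !inE; apply.
  by move=> x y Sx Sy; have := hD x y; rewrite !inE; apply.
split; first by rewrite inE.
  by move=> x y; rewrite !inE; apply: hB.
by move=> x y; rewrite !inE; apply: hD.
Qed.

Section Surjectivity.
Variables (K : fieldType) (L : closedFieldType) (iota : {rmorphism K -> L}) (g c : K).
Hypothesis L2 : (2 : L) != 0.
Hypothesis crit_indep : forall n (b : pred nat) x,
  crit_val g c n * \prod_(i < n | b i) crit_val g c i <> x ^+ 2.

Let phi : {poly K} := ('X - g%:P) ^+ 2 + c%:P.
Let f : L -> L := qmap (iota g) (iota c).

Lemma horner_map_phi x : (map_poly iota phi).[x] = f x.
Proof.
by rewrite /phi rmorphD rmorphXn rmorphB /= map_polyX !map_polyC !hornerE.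
Qed.

Lemma sqrt_exists : exists rt : L -> L, forall a, rt a ^+ 2 = a - iota c.
Proof.
suff /choice[rt rtE] : forall a : L, exists y, y ^+ 2 = a - iota c by exists rt.
move=> a; have [y yE] := solve_monicpoly (fun i => if i is 0%N then a - iota c else 0) (ltn0Sn 1).
by exists y; rewrite yE !big_ord_recl big_ord0 /= mulr1 mul0r !addr0.
Qed.

Section WithRoots.
Variable rt : L -> L.
Hypothesis rtE : forall a, rt a ^+ 2 = a - iota c.

Local Notation Rs := (preim_seq iota g rt).
Local Notation Kt := (preim_field iota g rt).

Lemma uniq_Rs n : uniq (Rs n).
Proof.
by apply: (uniq_preim_seq L2 rtE) => j _; have [] := indep_all L2 rtE crit_indep j.
Qed.

Lemma map_iterp n : map_poly iota (iterp phi n) = \prod_(a <- Rs n) ('X - a%:P).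
Proof.
elim: n => [|n IH]; first by rewrite /iterp /= map_polyX big_seq1 subr0.
rewrite /iterp iterS map_comp_poly -/(iterp phi n) IH rmorph_prod.
rewrite preim_seqS [RHS]big_allpairs_dep.
apply: eq_bigr => a _.
rewrite !big_cons big_nil /= mulr1 rmorphB /= comp_polyX comp_polyC.
rewrite /phi rmorphD rmorphXn rmorphB /= map_polyX !map_polyC /=.
have {1}-> : a = rt a ^+ 2 + iota c by rewrite rtE subrK.
by rewrite mul1r mulN1r !rmorphD rmorphN rmorphXn /=; ring.
Qed.

Lemma iter_rootE n x : iter_root iota phi n x = (x \in Rs n).
Proof. by rewrite /iter_root map_iterp root_prod_XsubC. Qed.

Lemma separable_iterp n : separable_poly (iterp phi n).
Proof. by rewrite -(separable_map iota) map_iterp separable_prod_XsubC uniq_Rs. Qed.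

Lemma splitting_subfieldE n : splitting_subfield iota phi n = Kt n.
Proof.
apply/seteqP; split=> x.
  apply; split; first exact/divring_closedP/(preim_subfield g rtE).
  move=> y [[a _ <-]|]; first exact: (preim_field_base g rtE).
  by rewrite /= iter_rootE => /(preim_field_root rtE).
move=> Kx S [/divring_closedP sS SG].
apply: (preim_field_min rtE sS) Kx => [a|b bR]; first by apply: SG; left; exists a.
by apply: SG; right; rewrite /= iter_rootE.
Qed.

Lemma base_hom_inj n sigma x y : base_hom iota g rt n sigma -> Kt n x -> Kt n y ->
  sigma x = sigma y -> x = y.
Proof.
move=> hs Kx Ky sxy; apply: contrapT => /eqP; rewrite -subr_eq0 => xy0.
have sK := preim_subfield g rtE n.
have Kxy : Kt n (x - y) by apply: (subfB sK).
have [[s1 sD sM] si] := hs.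
have : sigma ((x - y) * (x - y)^-1) = 0.
  by rewrite sM ?(base_homB rtE hs) ?sxy ?subrr ?mul0r //; apply: (subfV sK).
by rewrite mulfV // s1 => /eqP; rewrite oner_eq0.
Qed.

(** Surjectivity: the image is a subfield that contains the base field and, by
    injectivity on a finite set, all roots of level [n]. *)
Lemma base_hom_Gal n sigma : base_hom iota g rt n sigma -> Gal_level iota phi n sigma.
Proof.
move=> hs; have [[s1 sD sM] si] := hs; have sK := preim_subfield g rtE n.
rewrite /Gal_level splitting_subfieldE; split=> //.
- split.
  + by move=> x Kx; apply: (base_hom_stable rtE hs).
  + by move=> x y /set_mem Kx /set_mem Ky; apply: (base_hom_inj hs).
  + apply: (preim_field_min rtE).
    * split; first by exists 1; [apply: (subf1 sK)|].
        move=> _ _ [x Kx <-] [y Ky <-]; exists (x - y); first exact: (subfB sK).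
        exact: (base_homB rtE hs).
      move=> _ _ [x Kx <-] [y Ky <-].
      have [->|y0] := eqVneq y 0.
        exists 0; first exact: (subf0 sK).
        by rewrite -(rmorph0 iota) si rmorph0 invr0 mulr0.
      have KV : Kt n y^-1 by apply: (subfV sK).
      have sy : sigma y * sigma y^-1 = 1 by rewrite -sM // mulfV.
      have sy0 : sigma y != 0.
        by apply: contraNneq (oner_neq0 L) => sy0; rewrite -sy sy0 mul0r.
      exists (x / y); first exact: (subf_div sK).
      by rewrite sM // -[sigma y^-1](mulKf sy0) sy mulr1.
    * by move=> a; exists (iota a); [apply: (preim_field_base g rtE)|apply: si].
    * move=> b bR.
      have usR : uniq [seq sigma a | a <- Rs n].
        rewrite map_inj_in_uniq ?uniq_Rs // => x y xR yR.
        by apply: (base_hom_inj hs); apply: (preim_field_root rtE).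
      have sub : {subset [seq sigma a | a <- Rs n] <= Rs n}.
        by move=> _ /mapP[a aR ->]; apply: (base_hom_root rtE hs).
      have [_ eqR] := uniq_min_size usR sub (eq_leq (esym (size_map _ _))).
      move: bR; rewrite -eqR => /mapP[a aR ->].
      by exists a => //; apply: (preim_field_root rtE).
- by move=> x y /set_mem Kx /set_mem Ky; apply: sD.
- by move=> x y /set_mem Kx /set_mem Ky; apply: sM.
Qed.

Local Notation vertex := (vertex iota phi).
Local Notation level := (@Defs.level K L iota phi).
Local Notation point := (@Defs.point K L iota phi).

Variable s : vertex -> vertex.
Hypothesis s_aut : tree_aut s.

Definition follows n sigma := base_hom iota g rt n sigma /\
  forall v, level v = n -> sigma (point v) = point (s v).

(** For each root [a] of level [n], the automorphism [s] sends the child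
    [g + rt a] to one of the two children of [sigma a]; this prescribes the sign
    with which [sigma] is extended to [rt a]. The other child then follows,
    because [s] is injective. *)
Lemma follows_ext n sigma : follows n sigma -> exists tau, follows n.+1 tau /\
  forall x, Kt n x -> tau x = sigma x.
Proof.
move=> [hs sv].
have [bs _ _] := s_aut.
have indn : indep iota g rt n by have [] := indep_all L2 rtE crit_indep n.
have plusR a : a \in Rs n -> iter_root iota phi n.+1 (iota g + rt a).
  move=> aR; rewrite iter_rootE; apply/allpairsP; exists (a, 1); split=> //.
    by rewrite inE eqxx.
  by rewrite mul1r.
(* [eps a] is the sign for [rt a]: whether [s] exchanges the labels [+] and [-]
   of the children of [a]. *)
pose eps a := `[< exists v, [/\ level v = n.+1, point v = iota g + rt a &
  point (s v) <> iota g + rt (sigma a)] >].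
have [tau [ht ts trt]] := base_hom_extS L2 rtE eps (uniq_Rs n) indn hs.
exists tau; split=> //; split=> // v lv.
have [w pw] := parent_exists lv.
have [lsv /(_ w pw) psw] := tree_aut_level s_aut lv.
have lw : level w = n by case/andP: pw; rewrite lv => /eqP [].
have aR : point w \in Rs n by have := valP w; rewrite iter_rootE -/(level w) lw.
pose a := point w; have saE : sigma a = point (s w) by apply: sv.
have child x (u u' : vertex) : parent_of u u' -> x = point u' ->
    x = iota g + rt (point u) \/ x = iota g - rt (point u).
  move=> /andP[_ /eqP]; rewrite horner_map_phi => pE ->.
  have : (point u' - iota g) ^+ 2 == rt (point u) ^+ 2.
    by rewrite rtE pE /f /qmap addrK.
  by rewrite eqf_sqr => /orP[] /eqP <-; [left|right]; rewrite ?opprK subrKC.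
have tg : tau (iota g) = iota g by case: ht.
have Kg := preim_field_base g rtE n.+1 g.
have Krt : Kt n.+1 (rt a) by apply: (preim_field_rt rtE).
have [[_ tD _] _] := ht.
have ra0 : rt a != 0 := indep_rt_neq0 rtE indn aR.
have r0 x : x \in Rs n -> iota g + rt x != iota g - rt x.
  move=> xR; rewrite (inj_eq (addrI _)) -subr_eq0 opprK -mulr2n -mulr_natl.
  by rewrite mulf_neq0 // (indep_rt_neq0 rtE indn xR).
have sR : sigma a \in Rs n by apply: (base_hom_root rtE hs).
pose vp : vertex := exist _ (n.+1, iota g + rt a) (plusR a aR).
have epsE : eps a = (point (s vp) != iota g + rt (sigma a)).
  apply/asboolP/negP => [[u [lu pu su]] /eqP uE|h]; last by exists vp; split=> // /eqP.
  by apply: su; rewrite (_ : u = vp) //; apply: vertex_eq; rewrite ?lu ?pu.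
have pvp : parent_of w vp.
  apply/andP; split; first by rewrite lw.
  rewrite horner_map_phi /f /qmap [point vp]/(iota g + rt a) addrAC subrr add0r.
  by rewrite rtE subrK.
have [_ /(_ w pvp) psvp] := @tree_aut_level _ _ _ _ _ s_aut n.+1 vp erefl.
have tplus : tau (iota g + rt a) = point (s vp).
  rewrite tD // tg trt // epsE.
  have := child _ _ _ psvp erefl; rewrite -saE => -[->|->].
    by rewrite eqxx mul1r.
  by rewrite eq_sym r0 // expr1 mulN1r.
have [vE|vE] := child _ _ _ pw erefl.
  have -> : v = vp by apply: vertex_eq; rewrite ?lv.
  exact: tplus.
have vvp : v <> vp.
  by move=> vvp; have := r0 a aR; rewrite -vE vvp eqxx.
have spv : point (s v) <> point (s vp).
  move=> E; apply: vvp; apply: (bij_inj bs); apply: vertex_eq => //.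
  by have [-> _] := @tree_aut_level _ _ _ _ _ s_aut n.+1 vp erefl.
have sumv : point (s v) + point (s vp) = iota g + iota g.
  move: spv; have := child _ _ _ psw erefl; have := child _ _ _ psvp erefl.
  by move=> -[->|->] -[->|->] // _; ring.
rewrite vE (base_homB rtE ht) // tg; apply: (addIr (point (s vp))); rewrite sumv.
by rewrite -tplus tD // tg; ring.
Qed.

Lemma exists_lift : exists2 gs, Gal_lim iota phi gs & induces gs s.
Proof.
have [bs sroot _] := s_aut.
have step (p : nat * (L -> L)) : exists tau, follows p.1 p.2 ->
    follows p.1.+1 tau /\ forall x, Kt p.1 x -> tau x = p.2 x.
  have [h|nh] := pselect (follows p.1 p.2); last by exists id => /nh.
  by have [tau] := follows_ext h; exists tau.
have [next nextP] := choice step.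
pose gs := fix gs n := if n is n'.+1 then next (n', gs n') else id.
have gsP n : follows n (gs n).
  elim: n => [|n IH]; last by have [] := nextP (n, gs n) IH.
  split; first by split.
  move=> v lv; have -> : v = tree_root iota phi; last by rewrite sroot.
  apply: vertex_eq; rewrite ?lv //.
  have := valP v; rewrite /= -/(level v) lv /iter_root /= map_polyX.
  by rewrite /root hornerX => /eqP.
exists gs.
  split=> n; first by apply: base_hom_Gal; case: (gsP n).
  move=> x; rewrite splitting_subfieldE => /set_mem Kx.
  by have [_ h] := nextP (n, gs n) (gsP n); apply: h.
move=> v; have [lv _] := tree_aut_level s_aut (erefl (level v)).
by split=> //; have [_ ->] := gsP (level v).
Qed.
End WithRoots.

Theorem arboreal_surjective_of_crit : arboreal_surjective iota phi.
Proof.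
have [rt rtE] := sqrt_exists; split=> [n _|s hs]; first exact: (separable_iterp rtE).
have lift := exists_lift rtE hs; exact: lift.
Qed.
End Surjectivity.

(** * From Q[t] to Q(t) *)

Lemma fraction_num_den (R : idomainType) (x : {fraction R}) :
  exists n d, d != 0 /\ x * tofrac d = tofrac n.
Proof.
elim/quotW: x => r; exists (frac r).1, (frac r).2.
split; first exact: denom_ratioP.
rewrite !piE /FracField.mulf !numden_Ratio ?oner_eq0 // mulr1.
apply/eqmodP; rewrite /= FracField.equivfE !numden_Ratio ?mulf_neq0 ?oner_eq0 ?denom_ratioP //.
by rewrite !mulr1 mulrC.
Qed.

(** Q[t] is integrally closed: the denominator of a square root divides its
    numerator. *)
Lemma tofrac_sqr (F : fieldType) (p : {poly F}) (x : {fraction {poly F}}) :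
  tofrac p = x ^+ 2 -> exists h, p = h ^+ 2.
Proof.
have [n [d [d0 xd]]] := fraction_num_den x => px.
have pd : p * d ^+ 2 = n ^+ 2.
  apply/eqP; rewrite -tofrac_eq tofracM !tofracXn px -xd exprMn; exact: eqxx.
have : d ^+ 2 %| n ^+ 2 by rewrite -pd dvdp_mull.
rewrite dvdp_pexp2r // => /dvdpP [h hE]; exists h.
by apply: (mulIf (expf_neq0 2 d0)); rewrite pd hE exprMn.
Qed.

Lemma Zt_to_QtE p : Zt_to_Qt p = tofrac (ratpoly p).
Proof. by []. Qed.

Lemma crit_val_tofrac (g e : {poly rat}) n :
  crit_val (tofrac g) (tofrac (e + g)) n = tofrac (adj_crit e g n).
Proof.
have iterE k : iter k (qmap (tofrac g) (tofrac (e + g))) (tofrac (e + g)) =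
    tofrac (orb e 0 k.+1 + g).
  elim: k => [|k IH]; first by rewrite orbS expr0n add0r.
  by rewrite iterS IH [in RHS]orbS /qmap -tofracB addrK -tofracXn -tofracD addrA.
case: n => [|n]; last exact: iterE.
by rewrite /crit_val /adj_crit tofracN -iterE.
Qed.

Theorem quad_arboreal_surjective (Kbar : closedFieldType) (iota : {rmorphism Qt -> Kbar})
    (gamma c : {poly int}) (d : nat) (g := ratpoly gamma) (e := ratpoly c - ratpoly gamma) :
  (0 < d)%N -> size e = d.+1 -> size g = d.+1 -> size (ratpoly c) = d.+1 ->
  (forall i j, (i < j)%N -> (j < 12)%N ->
     coprimep (orb e 0 i.+1 + g) (orb e 0 j.+1 + g)) ->
  (forall y, - ratpoly c <> y ^+ 2) ->
  (forall r : rat, ratpoly c <> (r *+ 2) *: e + (r ^+ 2)%:P) ->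
  arboreal_surjective iota (quad gamma c).
Proof.
move=> d0 se sg sc cop nsq0 nsq1.
have cE : ratpoly c = e + g by rewrite subrK.
rewrite /quad !Zt_to_QtE -/g cE; apply: arboreal_surjective_of_crit.
  rewrite -(rmorph_nat iota 2) fmorph_eq0 -(rmorph_nat (@tofrac _) 2) tofrac_eq0.
  by rewrite -(rmorph_nat polyC 2) polyC_eq0 pnatr_eq0.
move=> n b x.
under eq_bigr do rewrite crit_val_tofrac.
rewrite crit_val_tofrac -rmorph_prod -tofracM => /tofrac_sqr [h].
apply: (crit_independent d0 se sg _ cop); rewrite -cE //.
Qed.

(** * Exceptional constant coefficients *)

(** A bound for the number of elements satisfying [Q] that is meaningful in an
    arbitrary type: they all lie in a list of length at most [C]. *)
Definition covered (W : eqType) (C : nat) (Q : W -> Prop) :=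
  exists2 s : seq W, (size s <= C)%N & forall w, Q w -> w \in s.

Lemma covered_sub (W : eqType) C (Q Q' : W -> Prop) :
  (forall w, Q w -> Q' w) -> covered C Q' -> covered C Q.
Proof. by move=> QQ [s sC sQ]; exists s => // w /QQ; apply: sQ. Qed.

Lemma covered_unique (W : eqType) (Q : W -> Prop) :
  (forall w w', Q w -> Q w' -> w = w') -> covered 1 Q.
Proof.
move=> uQ; have [[w0 Q0]|nQ] := pselect (exists w, Q w); last first.
  by exists [::] => // w Qw; case: nQ; exists w.
by exists [:: w0] => // w Qw; rewrite inE (uQ _ _ Qw Q0).
Qed.

Lemma covered_or (W : eqType) C C' (Q Q' : W -> Prop) :
  covered C Q -> covered C' Q' -> covered (C + C') (fun w => Q w \/ Q' w).
Proof.
move=> [s sC sQ] [s' sC' sQ']; exists (s ++ s'); first by rewrite size_cat leq_add.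
by move=> w [/sQ|/sQ']; rewrite mem_cat => ->; rewrite ?orbT.
Qed.

Lemma covered_big (W I : eqType) (l : seq I) C (Q : I -> W -> Prop) :
  (forall i, i \in l -> covered C (Q i)) ->
  covered (size l * C) (fun w => exists2 i, i \in l & Q i w).
Proof.
elim: l => [|i l IH] Ql; first by exists [::] => // w [].
rewrite /= mulSn; apply: (@covered_sub _ _ _ (fun w => Q i w \/ exists2 j, j \in l & Q j w)).
  move=> w [j]; rewrite inE => /predU1P[->|jl] Qj; first by left.
  by right; exists j.
apply: covered_or; first by apply: Ql; rewrite mem_head.
by apply: IH => j jl; apply: Ql; rewrite inE jl orbT.
Qed.

Lemma covered_roots (F : closedFieldType) (p : {poly F}) C : p != 0 -> (size p <= C.+1)%N ->
  covered C (root p).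
Proof.
move=> p0 sp; have [s pE] := closed_field_poly_normal p; exists s.
  by move: sp; rewrite pE size_scale ?lead_coef_eq0 // size_prod_XsubC.
by move=> w; rewrite pE rootZ ?lead_coef_eq0 // root_prod_XsubC.
Qed.

Lemma orb_morph (R S : nzRingType) (h : {rmorphism R -> S}) e y n :
  h (orb e y n) = orb (h e) (h y) n.
Proof. by elim: n => [//|n IH]; rewrite /orb !iterS -/(orb _ _ _) rmorphD rmorphXn IH. Qed.

Definition orbX n : {poly algC} := orb 'X 0 n.

Lemma horner_orbX n m : (orbX n).[m] = orb m 0 n.
Proof.
by rewrite -[LHS]/(horner_eval m (orbX n)) orb_morph /= /horner_eval hornerX horner0.
Qed.

Lemma orbX_neq i j : (i < j)%N -> orbX j.+1 - orbX i.+1 != 0.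
Proof.
move=> ij; have sX : size ('X : {poly algC})%R = 1.+1 by rewrite size_polyX.
rewrite subr_eq0; apply: contraTneq ij => E; have := size_v (ltn0Sn 0) sX j.
rewrite -/(orbX j.+1) E (size_v (ltn0Sn 0) sX i) !muln1 => -[] /eqP.
by rewrite eqn_exp2l // => /eqP ->; rewrite ltnn.
Qed.

Local Notation toC := (map_poly (intr : int -> algC)).

Lemma ratpolyC p : map_poly ratr (ratpoly p) = toC p.
Proof. by rewrite -map_poly_comp; apply: eq_map_poly => x /=; rewrite ratr_int. Qed.

Lemma not_coprimep_root (p q : {poly rat}) : ~~ coprimep p q ->
  exists t : algC, root (map_poly ratr p) t /\ root (map_poly ratr q) t.
Proof.
rewrite /coprimep -(size_map_poly (ratr : {rmorphism rat -> algC})).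
move=> /closed_rootP[t rt]; exists t.
by move: rt; rewrite gcdp_map root_gcd => /andP[].
Qed.

Section Exceptional.
Variables (d : nat) (gamma c0 : {poly int}).
Hypotheses (d_gt0 : (0 < d)%N) (size_gamma : size gamma = d.+1).

Definition same_tail (c : {poly int}) := [/\ size c = d.+1, size (c - gamma)%R = d.+1 &
  forall i, i != 0%N -> c`_i = c0`_i].

Definition const_term (c : {poly int}) : algC := (c`_0)%:~R.

Lemma same_tail_eq c c' : same_tail c -> same_tail c' -> c - c' = (c`_0 - c'`_0)%:P.
Proof.
move=> [_ _ h] [_ _ h']; apply/polyP => i; rewrite coefB coefC.
by case: eqP => [->//|/eqP i0]; rewrite h // h' // subrr.
Qed.

Lemma ratpolyB p q : ratpoly (p - q) = ratpoly p - ratpoly q.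
Proof. exact: rmorphB. Qed.

Lemma size_ratpoly p : size (ratpoly p)%R = size p.
Proof.
have [->|p0] := eqVneq p 0; first by rewrite /ratpoly map_poly0 !size_poly0.
by rewrite size_map_poly_id0 // intr_eq0 lead_coef_eq0.
Qed.

(** If [- c] and [- c'] are squares [y^2] and [y'^2] and [c - c'] is a non-zero
    constant, then [y' - y] and [y' + y] are constant, and so is [c']. *)
Lemma covered_square : covered 1 (fun w => exists c, [/\ same_tail c, w = const_term c &
  exists y, - ratpoly c = y ^+ 2]).
Proof.
apply: covered_unique => w w' [c [tc -> [y yE]]] [c' [tc' -> [y' yE']]].
have cc' := same_tail_eq tc tc'; apply/eqP; rewrite -subr_eq0 -rmorphB intr_eq0.
apply/negPn/negP => k0.
have prodE : (y' - y) * (y' + y) = ((c`_0 - c'`_0)%:~R)%:P.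
  have -> : (y' - y) * (y' + y) = y' ^+ 2 - y ^+ 2 by ring.
  by rewrite -yE -yE' opprK addrC -rmorphB /= cc' /ratpoly map_polyC.
have : size ((y' - y) * (y' + y))%R == 1%N by rewrite prodE size_polyC intr_eq0 k0.
rewrite size_mul_eq1 => /andP[/eqP s1 /eqP s2].
have sy' : (size y' <= 1)%N.
  rewrite -(@size_scale _ 2) ?pnatr_eq0 // scaler_nat.
  have -> : y' *+ 2 = (y' - y) + (y' + y) by ring.
  by apply: size_add_le; rewrite ?s1 ?s2.
have : (size (y' ^+ 2)%R <= 1)%N by rewrite expr2 (@size_mul_le _ _ _ 0 0).
by rewrite -yE' size_polyN size_ratpoly; have [-> _ _] := tc'; case: d d_gt0.
Qed.

(** The coefficients of degree [d] determine [r]; then those of degree [0] give a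
    linear equation for the constant coefficient of [c]. It is non-degenerate
    because [2 r = 1] would force the coefficient of degree [d] of [gamma] to
    vanish. *)
Lemma covered_split : covered 1 (fun w => exists c, [/\ same_tail c, w = const_term c &
  exists r : rat, ratpoly c = (r *+ 2) *: (ratpoly c - ratpoly gamma) + (r ^+ 2)%:P]).
Proof.
apply: covered_unique => w w' [c [tc -> [r rE]]] [c' [tc' -> [r' rE']]].
have coefE (b : {poly int}) s i : ratpoly b = (s *+ 2) *: (ratpoly b - ratpoly gamma) + (s ^+ 2)%:P ->
    (b`_i)%:~R = (s *+ 2) * ((b`_i)%:~R - (gamma`_i)%:~R) + (if i == 0%N then s ^+ 2 else 0) :> rat.
  move=> /(congr1 (fun p : {poly rat} => p`_i)).
  by rewrite coefD coefZ coefB coefC /ratpoly !coef_map.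
have [sc scg tail] := tc; have [_ _ tail'] := tc'.
have d0 : d != 0%N by rewrite -lt0n.
have gd : (gamma`_d)%:~R != 0 :> rat.
  rewrite intr_eq0; have : lead_coef gamma != 0 by rewrite lead_coef_eq0 -size_poly_eq0 size_gamma.
  by rewrite lead_coefE size_gamma.
have cgd : (c`_d)%:~R - (gamma`_d)%:~R != 0 :> rat.
  rewrite -rmorphB intr_eq0.
  have : lead_coef (c - gamma) != 0 by rewrite lead_coef_eq0 -size_poly_eq0 scg.
  by rewrite lead_coefE scg coefB.
have Ed := coefE c r d rE; have := coefE c' r' d rE'.
rewrite tail' // -tail // (negPf d0) addr0 => Ed'.
rewrite (negPf d0) addr0 in Ed.
have rr' : r = r'.
  have : (r *+ 2) * ((c`_d)%:~R - (gamma`_d)%:~R) = (r' *+ 2) * ((c`_d)%:~R - (gamma`_d)%:~R) :> rat.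
    by rewrite -Ed -Ed'.
  by move/(mulIf cgd)/eqP; rewrite eqr_pMn2r // => /eqP.
have r1 : 1 - r *+ 2 != 0.
  apply: contraNneq gd => r1; have r2 : r *+ 2 = 1 by apply/eqP; rewrite eq_sym -subr_eq0 r1.
  by move/eqP: Ed; rewrite r2 mul1r -subr_eq0 opprB addrC subrK.
have E0 := coefE c r 0%N rE; have E0' := coefE c' r' 0%N rE'.
rewrite /= -rr' in E0 E0'.
have : (1 - r *+ 2) * ((c`_0)%:~R - (c'`_0)%:~R) = 0 :> rat.
  have -> : (1 - r *+ 2) * ((c`_0)%:~R - (c'`_0)%:~R) =
    ((c`_0)%:~R - r *+ 2 * (c`_0)%:~R) - ((c'`_0)%:~R - r *+ 2 * (c'`_0)%:~R) :> rat by ring.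
  by rewrite {1}E0 {1}E0'; ring.
move/eqP; rewrite mulf_eq0 (negPf r1) /= subr_eq0 eqr_int => /eqP E.
by rewrite /const_term E.
Qed.

Lemma covered_image (W W' : eqType) C (Q : W -> Prop) (h : W -> W') :
  covered C Q -> covered C (fun w => exists2 t, Q t & w = h t).
Proof.
move=> [s sC sQ]; exists [seq h t | t <- s]; first by rewrite size_map.
by move=> w [t /sQ ts ->]; apply: map_f.
Qed.

Lemma size_toC p : size (toC p)%R = size p.
Proof. by rewrite -ratpolyC size_map_poly size_ratpoly. Qed.

Lemma root_orb (p q : {poly rat}) n (t : algC) :
  root (map_poly ratr (orb p 0 n + q)) t ->
  (orbX n).[(map_poly ratr p).[t]] = - (map_poly ratr q).[t].
Proof.
rewrite rmorphD /= orb_morph rmorph0 /root hornerD addr_eq0 => /eqP <-.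
by rewrite horner_orbX -[RHS]/(horner_eval t _) orb_morph rmorph0.
Qed.

(** At a common root [t], the value [m] of [c - gamma] is a root of
    [orbX j.+1 - orbX i.+1], and [t] is a root of [gamma + orbX i.+1 (m)].
    Both facts leave finitely many possibilities, and the constant coefficient
    is [m + gamma(t)] minus the value at [t] of the other terms of [c]. *)
Lemma covered_common_root i j : (i < j)%N ->
  covered ((size (orbX j.+1 - orbX i.+1)%R).-1 * d) (fun w => exists c, [/\ same_tail c,
    w = const_term c &
    ~~ coprimep (orb (ratpoly c - ratpoly gamma) 0 i.+1 + ratpoly gamma)
                (orb (ratpoly c - ratpoly gamma) 0 j.+1 + ratpoly gamma)]).
Proof.
move=> ij.
have [sm szm sm_root] := covered_roots (orbX_neq ij) (leqSpred _).
pose G := toC gamma; pose c1 := toC c0 - (const_term c0)%:P.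
have covm m : m \in sm -> covered d (fun w => exists2 t,
    root (G + ((orbX i.+1).[m])%:P) t & w = m + G.[t] - c1.[t]).
  move=> _; apply: covered_image; apply: covered_roots.
    rewrite -size_poly_eq0 size_polyDl size_toC size_gamma //.
    by rewrite ltnS (leq_trans (size_polyC_leq1 _)).
  rewrite size_polyDl size_toC size_gamma //.
  by rewrite ltnS (leq_trans (size_polyC_leq1 _)).
have [s szs sP] := covered_big covm; exists s.
  by apply: leq_trans szs _; rewrite leq_mul2r szm orbT.
move=> w [c [[sc scg tail] -> /not_coprimep_root[t [/root_orb rti /root_orb rtj]]]].
apply: sP; exists (map_poly ratr (ratpoly c - ratpoly gamma)).[t].
  by apply: sm_root; rewrite /root hornerD hornerN rti rtj subrr.
exists t.
  by rewrite /root hornerD hornerC rti ratpolyC subrr.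
rewrite rmorphB /= !ratpolyC hornerD hornerN subrK -hornerN -hornerD.
have -> : toC c - c1 = (const_term c)%:P; last by rewrite hornerC.
apply/polyP => k; rewrite !coefB !coefC !coef_map /=.
case: eqP => [->|/eqP k0]; first by rewrite /const_term subrr subr0.
by rewrite subr0 tail // subrr.
Qed.
End Exceptional.

(** The constant [C] depends only on [d] and [N], not on [gamma] or [c0]: this
    uniformity is what the count needs. *)
Lemma exceptional_constants (d N : nat) : (0 < d)%N ->
  exists C, forall gamma c0 : {poly int}, size gamma = d.+1 ->
  covered C (fun w => exists c, [/\ same_tail d gamma c0 c, w = const_term c &
   [\/ exists y, - ratpoly c = y ^+ 2,
       exists r : rat, ratpoly c = (r *+ 2) *: (ratpoly c - ratpoly gamma) + (r ^+ 2)%:P |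
       exists i j, [/\ (i < j)%N, (j < N)%N &
         ~~ coprimep (orb (ratpoly c - ratpoly gamma) 0 i.+1 + ratpoly gamma)
                     (orb (ratpoly c - ratpoly gamma) 0 j.+1 + ratpoly gamma)]]]).
Proof.
move=> d0.
pose K := \max_(i < N) \max_(j < N) ((size (orbX j.+1 - orbX i.+1)%R).-1 * d)%N.
pose l := [seq ij <- [seq (i, j) | i <- iota 0 N, j <- iota 0 N] | (ij.1 < ij.2)%N].
exists (1 + (1 + size l * K))%N => gamma c0 sg.
have cov ij : ij \in l -> covered K (fun w => exists c, [/\ same_tail d gamma c0 c,
    w = const_term c &
    ~~ coprimep (orb (ratpoly c - ratpoly gamma) 0 ij.1.+1 + ratpoly gamma)
                (orb (ratpoly c - ratpoly gamma) 0 ij.2.+1 + ratpoly gamma)]).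
  case: ij => i j; rewrite mem_filter => /andP[/= lt_ij /allpairsP[[i' j'] /= []]].
  rewrite !mem_iota /= !add0n => lt_i lt_j [? ?]; subst i' j'.
  have [s szs sP] := covered_common_root c0 d0 sg lt_ij; exists s => //.
  apply: leq_trans szs _; rewrite /K.
  apply: leq_trans (leq_bigmax (Ordinal lt_i)).
  by apply: leq_trans (leq_bigmax (Ordinal lt_j)).
have := covered_or (covered_square gamma c0 d0) (covered_or (covered_split c0 d0 sg) (covered_big cov)).
apply: covered_sub => w [c [tc wE [h|h|[i [j [ij jN h]]]]]].
- by left; exists c.
- by right; left; exists c.
right; right; exists (i, j); last by exists c.
rewrite mem_filter ij /=; apply/allpairsP; exists (i, j).
by rewrite !mem_iota /= jN (ltn_trans ij).
Qed.

(** * Counting pairs in the box *)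

(** Fixing all coordinates but one leaves at most [C] values for the last one.
    The map [h] allows the exceptional values to be listed in another type. *)
Lemma card_slice (V : finType) (W : eqType) (h : V -> W) n (k : 'I_n.+1)
    (Y : {set {ffun 'I_n.+1 -> V}}) C : injective h ->
  (forall f0 : {ffun 'I_n.+1 -> V}, covered C (fun w => exists f,
     [/\ f \in Y, forall j, j != k -> f j = f0 j & w = h (f k)])) ->
  (#|Y| <= C * #|V| ^ n)%N.
Proof.
move=> hi cov; pose r (f : {ffun 'I_n.+1 -> V}) := [ffun j : 'I_n => f (lift k j)].
rewrite -sum1_card (partition_big r xpredT) //= mulnC.
have <- : #|{ffun 'I_n -> V}| = (#|V| ^ n)%N by rewrite card_ffun card_ord.
rewrite -sum_nat_const; apply: leq_sum => g _.
rewrite sum1dep_card; set A := [set _ | _].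
have [A0|[f0 f0A]] := set_0Vmem A; first by rewrite A0 cards0.
have /andP[f0Y /eqP rf0] : (f0 \in Y) && (r f0 == g) by move: f0A; rewrite inE.
have [s szs sP] := cov f0; apply: leq_trans szs.
have same f : f \in A -> forall j, j != k -> f j = f0 j.
  rewrite inE => /andP[_ /eqP rf] j jk; have [i ->|/eqP] := unliftP k j; last by rewrite (negPf jk).
  by have := congr1 (fun u : {ffun 'I_n -> V} => u i) (etrans rf (esym rf0)); rewrite !ffunE.
rewrite cardE -(size_map (fun f : {ffun 'I_n.+1 -> V} => h (f k))).
apply: uniq_leq_size.
  rewrite map_inj_in_uniq ?enum_uniq // => f f'; rewrite !mem_enum => fA f'A /hi E.
  apply/ffunP => j; have [->//|jk] := eqVneq j k.
  by rewrite (same f) // (same f').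
move=> w /mapP[f]; rewrite mem_enum => fA ->; apply: sP; exists f; split=> //.
  by move: fA; rewrite inE => /andP[].
exact: same.
Qed.

Lemma card_le_fibers1 (S T : finType) (Z : {set S * T}) K :
  (forall a, #|[set b | (a, b) \in Z]| <= K)%N -> (#|Z| <= #|S| * K)%N.
Proof.
move=> hK; rewrite -sum1_card (partition_big fst xpredT) //= -sum_nat_const.
apply: leq_sum => a _; apply: leq_trans (hK a); rewrite sum1dep_card.
rewrite -(card_imset _ (_ : injective (fun b : T => (a, b)))); last by move=> b b' [].
apply: subset_leq_card; apply/fintype.subsetP => -[a' b]; rewrite !inE => /andP[abZ /eqP /= E].
by subst a'; apply: imset_f; rewrite inE.
Qed.

Lemma card_le_fibers2 (S T : finType) (Z : {set S * T}) K :
  (forall b, #|[set a | (a, b) \in Z]| <= K)%N -> (#|Z| <= #|T| * K)%N.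
Proof.
move=> hK; pose sw (x : S * T) := (x.2, x.1).
have swi : injective sw by move=> [a b] [a' b'] [-> ->].
rewrite -(card_imset _ swi); apply: card_le_fibers1 => b; apply: leq_trans (hK b).
apply: subset_leq_card; apply/fintype.subsetP => a; rewrite !inE.
by move=> /imsetP[[a' b'] abZ [-> ->]].
Qed.

Lemma card_set_image (T : finType) (U : choiceType) (h : T -> U) (P : pred T) :
  injective h -> card_set (h @` [set` P])%classic = #|P|.
Proof.
move=> hi; rewrite /card_set.
have -> : (h @` [set` P])%classic = [set` [fset h x | x in P]%fset]%classic.
  apply/seteqP; split=> y.
    by move=> [x Px <-]; apply/imfsetP; exists x.
  by move=> /imfsetP[x Px ->]; exists x.
by rewrite set_fsetK card_imfset //= cardE.
Qed.

Section Box.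
Variables (d B : nat).
Local Notation M := (2 * B).+1.
Local Notation T := {ffun 'I_d.+1 -> 'I_M}.

(** An index [v] below [2 B + 1] stands for the coefficient [v - B], so that
    polynomials of the box are functions between finite types. *)
Definition box_coef (v : 'I_M) : int := (v : nat)%:Z - B%:Z.
Definition box_poly (f : T) : {poly int} := \poly_(i < d.+1) box_coef (f (inord i)).

Lemma box_coef_inj : injective box_coef.
Proof. by move=> u v /(addIr _) [] /val_inj. Qed.

Lemma coef_box_poly f (i : 'I_d.+1) : (box_poly f)`_i = box_coef (f i).
Proof. by rewrite coef_poly ltn_ord inord_val. Qed.

Lemma box_poly_inj : injective box_poly.
Proof.
move=> f f' E; apply/ffunP => i; apply: box_coef_inj.
by rewrite -!coef_box_poly E.
Qed.

Lemma box_polyP p : bounded_polys d B p <-> exists f, p = box_poly f.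
Proof.
split=> [[sp pB]|[f ->]]; last first.
  split=> [|i]; first exact: size_poly.
  rewrite coef_poly; case: ifP => _; last by rewrite normr0.
  have := ltn_ord (f (inord i)); rewrite /box_coef; move: (f _ : nat) => v; lia.
exists [ffun i : 'I_d.+1 => inord (absz (p`_i + B%:Z))].
apply/polyP => i; rewrite coef_poly; case: ltnP => [lt_i|le_i]; last first.
  by rewrite nth_default //; apply: leq_trans le_i.
have iE : (inord i : 'I_d.+1) = i :> nat by rewrite inordK.
have pBi := pB i; rewrite ffunE /box_coef iE.
move: (p`_i) pBi => x xB; rewrite inordK; first by rewrite gez0_abs; lia.
by lia.
Qed.

Lemma card_box : #|{: T}| = (M ^ d.+1)%N.
Proof. by rewrite card_ffun !card_ord. Qed.

Lemma poly_pairsE : poly_pairs d B =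
  ((fun x : T * T => (box_poly x.1, box_poly x.2)) @` [set` predT])%classic.
Proof.
apply/seteqP; split=> [[p q] [/= /box_polyP[f ->] /box_polyP[f' ->]]|_ [[f f'] _ <-]].
  by exists (f, f').
by split; apply/box_polyP; [exists f | exists f'].
Qed.

Lemma card_poly_pairs : card_set (poly_pairs d B) = (M ^ (2 * d + 2))%N.
Proof.
rewrite poly_pairsE card_set_image.
  transitivity #|{: T * T}|; first exact: eq_card.
  by rewrite card_prod card_box -expnD; congr (_ ^ _)%N; lia.
by move=> [f f'] [u u'] [/box_poly_inj -> /box_poly_inj ->].
Qed.

Lemma size_box_poly (f : T) : box_coef (f ord_max) != 0 -> size (box_poly f) = d.+1.
Proof.
move=> f0; apply: size_poly_eq; have -> : (inord d : 'I_d.+1) = ord_max.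
  by apply: val_inj; rewrite /= inordK.
by [].
Qed.

Lemma size_box_poly_sub (f f' : T) : f ord_max != f' ord_max ->
  size (box_poly f - box_poly f')%R = d.+1.
Proof.
move=> ff'; apply/eqP; rewrite eqn_leq size_sub_le ?size_poly //=.
apply: contraR ff'; rewrite -ltnNge ltnS => /leq_sizeP/(_ d (leqnn d)).
rewrite coefB (coef_box_poly f ord_max) (coef_box_poly f' ord_max) => /eqP.
by rewrite subr_eq0 => /eqP/box_coef_inj ->.
Qed.

Section Surjective.
Variables (Kbar : closedFieldType) (iota : {rmorphism Qt -> Kbar}) (C : nat).
Hypothesis d_gt0 : (0 < d)%N.
Hypothesis exc : forall gamma c0 : {poly int}, size gamma = d.+1 ->
  covered C (fun w => exists c, [/\ same_tail d gamma c0 c, w = const_term c &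
   [\/ exists y, - ratpoly c = y ^+ 2,
       exists r : rat, ratpoly c = (r *+ 2) *: (ratpoly c - ratpoly gamma) + (r ^+ 2)%:P |
       exists i j, [/\ (i < j)%N, (j < 12)%N &
         ~~ coprimep (orb (ratpoly c - ratpoly gamma) 0 i.+1 + ratpoly gamma)
                     (orb (ratpoly c - ratpoly gamma) 0 j.+1 + ratpoly gamma)]]]).

Definition surjective_pair (x : T * T) : bool :=
  `[< arboreal_surjective iota (quad (box_poly x.1) (box_poly x.2)) >].

Lemma SurE : Sur iota d B =
  ((fun x : T * T => (box_poly x.1, box_poly x.2)) @` [set` surjective_pair])%classic.
Proof.
rewrite /Sur poly_pairsE; apply/seteqP; split=> [_ [[x _ <-] h]|_ [x /asboolP h <-]].
  by exists x => //; apply/asboolP.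
by split=> //; exists x.
Qed.

Lemma card_Sur : card_set (Sur iota d B) = #|surjective_pair|.
Proof.
rewrite SurE card_set_image //.
by move=> [f f'] [u u'] [/box_poly_inj -> /box_poly_inj ->].
Qed.

Let bad1 : {set T * T} := [set x : T * T | box_coef (x.1 ord_max) == 0].
Let bad2 : {set T * T} :=
  [set x : T * T | (box_coef (x.2 ord_max) == 0) || (x.2 ord_max == x.1 ord_max)].
Let bad3 : {set T * T} :=
  [set x : T * T | [&& box_coef (x.1 ord_max) != 0, box_coef (x.2 ord_max) != 0,
              x.2 ord_max != x.1 ord_max & ~~ surjective_pair x]].

(** Once [c] is fixed, the leading coefficient of [gamma] is determined. *)
Lemma card_bad1 : (#|bad1| <= M ^ d.+1 * (1 * M ^ d))%N.
Proof.
rewrite -card_box; apply: card_le_fibers2 => c; rewrite -[X in (X ^ d)%N](card_ord M).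
apply: (card_slice (k := ord_max) box_coef_inj) => f0.
apply: covered_unique => w w' [f [fY _ ->]] [f' [f'Y _ ->]].
by move: fY f'Y; rewrite !inE => /eqP -> /eqP ->.
Qed.

(** Once [gamma] is fixed, the leading coefficient of [c] takes two values. *)
Lemma card_bad2 : (#|bad2| <= M ^ d.+1 * (2 * M ^ d))%N.
Proof.
rewrite -card_box; apply: card_le_fibers1 => g; rewrite -[X in (X ^ d)%N](card_ord M).
apply: (card_slice (k := ord_max) box_coef_inj) => f0.
exists [:: 0; box_coef (g ord_max)] => // w [f [fY _ ->]].
by move: fY; rewrite !inE => /orP[-> //|/eqP ->]; rewrite eqxx orbT.
Qed.

(** Once [gamma] is fixed, the exceptional values of the constant coefficient of
    [c] are counted along the lines where the other coefficients are constant. *)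
Lemma card_bad3 : (#|bad3| <= M ^ d.+1 * (C * M ^ d))%N.
Proof.
rewrite -card_box; apply: card_le_fibers1 => g; rewrite -[X in (X ^ d)%N](card_ord M).
pose h (v : 'I_M) : algC := (box_coef v)%:~R.
have hi : injective h by move=> u v /intr_inj/box_coef_inj.
apply: (card_slice (k := ord0) hi) => f0.
have [g0|g0] := eqVneq (box_coef (g ord_max)) 0.
  exists [::] => // w [f [fY _ _]].
  by move: fY; rewrite !inE /= g0 eqxx.
have sg := size_box_poly g0.
apply: (covered_sub _ (exc (box_poly f0) sg)) => w [f [fY ff0 ->]].
move: fY; rewrite !inE /= => /and4P[_ c0 cg /asboolPn nsurj].
have sc := size_box_poly c0; have scg := size_box_poly_sub cg.
exists (box_poly f); split.
- split=> // i i0; have [lt_i|le_i] := ltnP i d.+1; last first.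
    by rewrite !nth_default // (leq_trans (size_poly _ _)).
  rewrite (coef_box_poly f (Ordinal lt_i)) (coef_box_poly f0 (Ordinal lt_i)) ff0 //.
- by rewrite /const_term (coef_box_poly f ord0).
apply: contrapT => nexc; apply: nsurj.
apply: (@quad_arboreal_surjective _ iota _ _ d) => //; rewrite ?size_ratpoly //.
- by rewrite /= -ratpolyB size_ratpoly.
- move=> i j ij jN; apply: contrapT => /negP ncop; apply: nexc.
  by apply: Or33; exists i, j.
- by move=> y yE; apply: nexc; apply: Or31; exists y.
- by move=> r rE; apply: nexc; apply: Or32; exists r.
Qed.

Lemma card_Sur_bounds :
  (card_set (Sur iota d B) <= M ^ (2 * d + 2))%N /\
  (M ^ (2 * d + 2) <= card_set (Sur iota d B) + (3 + C) * M ^ (2 * d + 1))%N.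
Proof.
have cT : #|{: T * T}| = (M ^ (2 * d + 2))%N.
  by rewrite card_prod card_box -expnD; congr (_ ^ _)%N; lia.
rewrite card_Sur -cT; split; first exact: max_card.
rewrite -(cardC surjective_pair) leq_add2l.
have sub : [predC surjective_pair] \subset bad1 :|: bad2 :|: bad3.
  apply/fintype.subsetP => x; rewrite !inE => nx.
  have -> : surjective_pair x = false by apply: negPf nx.
  rewrite andbT.
  by case: (box_coef _ == 0); case: (box_coef _ == 0); case: eqVneq.
apply: leq_trans (subset_leq_card sub) _.
apply: leq_trans (leq_card_setU _ _) _.
have := (leq_card_setU bad1 bad2).1; have := card_bad1; have := card_bad2; have := card_bad3.
rewrite (_ : 2 * d + 1 = d.+1 + d)%N; last by lia.
rewrite expnD; move: (M ^ d.+1)%N (M ^ d)%N #|bad1| #|bad2| #|bad3| #|_ :|: _| => p q x y z t.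
nia.
Qed.
End Surjective.
End Box.

(** * The asymptotic estimate *)

Local Open Scope classical_set_scope.

Section Asymptotics.
Variables (R : realType) (d K : nat) (N : nat -> nat).
Hypothesis N_bounds : forall B, (N B <= (2 * B).+1 ^ (2 * d + 2))%N /\
  ((2 * B).+1 ^ (2 * d + 2) <= N B + K * (2 * B).+1 ^ (2 * d + 1))%N.

(** The error [K (2 B + 1)^(2 d + 1)] is smaller than the stated one by a factor
    of order [B^(1/2) ln B]. *)
Lemma big_O_of_bounds : exists C : R, \forall B \near \oo,
  `|(N B)%:R - (2 * B%:R + 1) ^+ (2 * d + 2)|
     <= C * (B%:R `^ ((2 * d + 2)%:R - 2^-1) * ln B%:R).
Proof.
(* [3] bounds [(2 B + 1) / B], and [ln 2] bounds [ln B] from below for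
   [B >= 2]. *)
exists (K%:R * 3 ^+ (2 * d + 1) / ln 2).
exists 2 => // B /= B2.
have B1 : 1 <= B%:R :> R by rewrite ler1n; apply: leq_trans B2.
have ln2 : 0 < ln 2 :> R by rewrite ln_gt0 // ltr1n.
have lnB : ln 2 <= ln (B%:R : R) by rewrite ler_ln ?posrE ?ltr0n ?ler_nat //; apply: leq_trans B2.
have ME : (2 * B%:R + 1 : R) = ((2 * B).+1)%:R by rewrite -[RHS]natr1 natrM.
have [le1 le2] := N_bounds B.
have -> : `|(N B)%:R - (2 * B%:R + 1) ^+ (2 * d + 2)| =
    (2 * B%:R + 1) ^+ (2 * d + 2) - (N B)%:R :> R.
  by rewrite ler0_norm ?opprB // subr_le0 ME -natrX ler_nat.
apply: (@le_trans _ _ (K%:R * (2 * B%:R + 1) ^+ (2 * d + 1))).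
  by rewrite lerBlDl ME -!natrX -natrM -natrD ler_nat.
apply: (@le_trans _ _ (K%:R * 3 ^+ (2 * d + 1) * B%:R ^+ (2 * d + 1))).
  rewrite -mulrA ler_wpM2l // -exprMn lerXn2r ?nnegrE //; lra.
rewrite -!mulrA ler_wpM2l // ler_wpM2l ?exprn_ge0 //.
apply: (@le_trans _ _ (B%:R `^ ((2 * d + 2)%:R - 2^-1) * 1)).
  rewrite mulr1 -powR_mulrn ?ler0n // ler_powR // natrD [X in _ <= X - _]natrD.
  lra.
rewrite mulrCA ler_wpM2l ?powR_ge0 //.
by rewrite mulrC ler_pdivlMr // mul1r.
Qed.

Lemma cvg_ratio_of_bounds :
  (fun B : nat => (N B)%:R / ((2 * B).+1 ^ (2 * d + 2))%:R : R) @ \oo --> (1 : R).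
Proof.
apply: (@squeeze_cvgr _ _ _ _ (fun B => 1 - K%:R * harmonic B) (fun=> 1)).
- near=> B; have [le1 le2] := N_bounds B.
  have M0 k : 0 < ((2 * B).+1 ^ k)%:R :> R by rewrite ltr0n expn_gt0.
  rewrite ler_pdivlMr // ler_pdivrMr // mul1r ler_nat le1 andbT.
  rewrite mulrBl mul1r lerBlDr.
  apply: (@le_trans _ _ (N B + K * (2 * B).+1 ^ (2 * d + 1))%:R); first by rewrite ler_nat.
  rewrite natrD lerD2l natrM -mulrA ler_wpM2l //.
  rewrite mulrC ler_pdivlMr ?ltr0n // -natrM ler_nat.
  by rewrite (_ : 2 * d + 2 = (2 * d + 1) + 1)%N ?expnD ?leq_mul //; lia.
- rewrite -[X in _ --> X]subr0; apply: cvgB; first exact: cvg_cst.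
  by rewrite -(mulr0 (K%:R : R)); apply: cvgM; [apply: cvg_cst|apply: cvg_harmonic].
- exact: cvg_cst.
Unshelve. all: by end_near.
Qed.
End Asymptotics.

Theorem theorem1p5 (R : realType) (Kbar : closedFieldType)
    (iota : {rmorphism Qt -> Kbar}) (Kbar_algebraic : integralRange iota)
    (d : nat) (d_ge1 : (1 <= d)%N) :
  (exists C : R, \forall B \near \oo,
     `|(card_set (Sur iota d B))%:R - (2 * B%:R + 1) ^+ (2 * d + 2)|
       <= C * (B%:R `^ ((2 * d + 2)%:R - 2^-1) * ln B%:R)) /\
  ((fun B : nat => (card_set (Sur iota d B))%:R /
                   (card_set (poly_pairs d B))%:R : R) @ \oo --> (1 : R)).
Proof.
have [C exc] := @exceptional_constants d 12 d_ge1.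
have bounds B := card_Sur_bounds B iota d_ge1 exc.
split; first exact: big_O_of_bounds bounds.
under eq_fun do rewrite card_poly_pairs.
exact: cvg_ratio_of_bounds bounds.
Qed.
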